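(* Let Assumptions A, C and D hold, let $\gamma^\nu\in(0,1]$ satisfy $\lim_{\nu\to\infty}\gamma^\nu=0$ and $\sum_{\nu=0}^\infty\gamma^\nu=\infty$, let $x^0\in K$, and let $\{x^\nu\}$ be the (infinite) sequence generated by the simplified DSM algorithm. Then the whole sequence $\{x^\nu\}$ is bounded and contained in $K$, and each of its limit points is a KKT solution of problem (P).
   Context: **Problem.** $K\subseteq\mathbb R^n$ is nonempty, closed and convex; $f:\mathbb R^n\to\mathbb R$, $g:\mathbb R^n\to\mathbb R^m$, $h:\mathbb R^n\to\mathbb R^p$ are $C^{1,1}$ (continuously differentiable with locally Lipschitz gradients) on an open set containing $K$; $q:\mathbb R^n\to\mathbb R$ is convex on $K$ and locally Lipschitz continuous on an open set containing $K$. Problem (P): minimize $f(x)+q(x)$ subject to $g(x)\le 0$, $h(x)=0$, $x\in K$. ($f$ need not be convex.) **Notation.** $\nabla g(x)\in\mathbb R^{n\times m}$, $\nabla h(x)\in\mathbb R^{n\times p}$ are transposed Jacobians; $\alpha_+=\max\{0,\alpha\}$; $e^m$ is the all-ones vector of $\mathbb R^m$; $\mathbb B^p_\infty$ is the closed unit ball of $\|\cdot\|_\infty$ in $\mathbb R^p$; $N_C(x)$ is the normal cone to a convex set $C$ at $x$; $\partial q(x)$ is the subdifferential of $q$ at $x\in K$ in the sense of convex analysis, $\{v: q(y)\ge q(x)+v^T(y-x)\ \forall y\in K\}$. Put $\varphi(x)=\max_{i,j}\{g_i(x)_+,|h_j(x)|\}$. A limit point of a sequence is a limit of some subsequence. **KKT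 and eMFCQ.** $\hat x\in K$ is a KKT solution of (P) if $g(\hat x)\le0$, $h(\hat x)=0$ and there are $\xi\in N_{\mathbb R^m_-}(g(\hat x))$, $\pi\in\mathbb R^p$ with $0\in\nabla f(\hat x)+\partial q(\hat x)+\nabla g(\hat x)\xi+\nabla h(\hat x)\pi+N_K(\hat x)$. The eMFCQ holds at $\hat x\in K$ if $M_0(\hat x)=\{0\}$, where $M_0(x)=\{(\xi,\pi): \xi\in N_{\mathbb R^m_-}(g(x)-\varphi(x)e^m),\ \pi\in N_{\varphi(x)\mathbb B^p_\infty}(h(x)),\ 0\in\nabla g(x)\xi+\nabla h(x)\pi+N_K(x)\}$. **Assumption D.** On an open neighborhood of $K$, each $g_i$ is convex and $h(x)=Ax+b$ with $A\in\mathbb R^{p\times n}$, $b\in\mathbb R^p$; $K$ is bounded; the feasible set of (P) is nonempty; the eMFCQ holds at every point of $K$. **Assumption A (in this setting).** $\beta>0$ is larger than the diameter of $K$ in $\|\cdot\|_\infty$; $O_d$ and $O_x$ are open neighborhoods of $\beta\mathbb B^n_\infty$ and $K$; $\tilde f:O_d\times O_x\to\mathbb R$ is continuously differentiable on $O_d$ with respect to the first argument (partial gradient $\nabla_1$), and: A1) $\tilde f(\cdot;x)$ is strongly convex on $O_d$ for every $x\in K$ with modulus $c>0$ independent of $x$; A2) $\tilde f$ is continuous on $O_d\times O_x$; A3) $\nabla_1\tilde f$ is continuous on $O_d\times O_x$; A4) $\nabla_1\tilde f(0;x)=\nabla f(x)$ for $x\in K$. (The remaining parts A5–A9 of the assumption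 concern the surrogate of $g$, which here is the linearization $\tilde g(d;x)=g(x)+\nabla g(x)^Td$, so they hold automatically.) **Assumption C.** $\tilde f$ is locally Lipschitz continuous on $O_d\times O_x$ (the analogous requirement on the surrogate of $g$ is automatic for the linearization). **Subproblem.** For $x\in K$, $d(x)$ is the unique solution of (P$^c_x$): minimize over $d$ the function $\tilde f(d;x)+q(x+d)$ subject to $g(x)+\nabla g(x)^Td\le0$, $A(x+d)+b=0$, $d\in K-x$. **Simplified DSM algorithm.** Start from $x^0\in K$. At iteration $\nu=0,1,\dots$: if $x^\nu$ is a KKT solution of (P), stop; otherwise compute $d(x^\nu)$ and set $x^{\nu+1}=x^\nu+\gamma^\nu d(x^\nu)$. The sequence considered is infinite, i.e. the algorithm does not stop. *)

(* Defs.v *)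
From mathcomp Require Import all_boot all_order all_algebra.
From mathcomp Require Import all_classical all_reals all_analysis.

Set Implicit Arguments.
Unset Strict Implicit.
Unset Printing Implicit Defensive.

Import Order.TTheory GRing.Theory Num.Theory.
Import numFieldNormedType.Exports.

Local Open Scope classical_set_scope.
Local Open Scope ring_scope.

(* Points of R^n are column vectors. The library norm `|x| on matrices is the
   sup norm; dot is the Euclidean inner product. *)

Definition dot (R : realType) (n : nat) (u v : 'cV[R]_n) : R :=
  \sum_(i < n) u i 0 * v i 0.

Definition linf_ball (R : realType) (n : nat) (r : R) : set 'cV[R]_n :=
  [set x | `|x| <= r].

Definition nonpos_orthant (R : realType) (m : nat) : set 'cV[R]_m :=
  [set y | forall i, y i 0 <= 0].

Definition gradient (R : realType) (n : nat) (f : 'cV[R]_n -> R)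
    (x : 'cV[R]_n) : 'cV[R]_n :=
  \col_(i < n) 'd f x (delta_mx i 0).

(* transposed Jacobian: column j is the gradient of the j-th component *)
Definition tjacobian (R : realType) (n m : nat) (g : 'cV[R]_n -> 'cV[R]_m)
    (x : 'cV[R]_n) : 'M[R]_(n, m) :=
  \matrix_(i < n, j < m) ('d g x (delta_mx i 0) : 'cV[R]_m) j 0.

(* Pointwise form; the library's [locally [lipschitz _ | _ in U]] ranges over
   neighborhoods of all pairs of points of U. *)
Definition locally_lipschitz (R : realType) (V W : normedModType R)
    (U : set V) (F : V -> W) : Prop :=
  forall x, U x -> exists k : R, exists2 B, nbhs x B & k.-lipschitz_B F.

Definition C11 (R : realType) (n : nat) (U : set 'cV[R]_n)
    (f : 'cV[R]_n -> R) : Prop :=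
  (forall x, U x -> differentiable f x) /\ locally_lipschitz U (gradient f).

Definition C11_vec (R : realType) (n m : nat) (U : set 'cV[R]_n)
    (g : 'cV[R]_n -> 'cV[R]_m) : Prop :=
  (forall x, U x -> differentiable g x) /\ locally_lipschitz U (tjacobian g).

(* D need not be convex: only segments lying in D are constrained. *)
Definition strongly_convex_on (R : realType) (n : nat) (c : R)
    (D : set 'cV[R]_n) (f : 'cV[R]_n -> R) : Prop :=
  forall u v, D u -> D v ->
    (forall t : R, 0 <= t <= 1 -> D (t *: u + (1 - t) *: v)) ->
  forall t : R, 0 <= t <= 1 ->
    f (t *: u + (1 - t) *: v) <=
    t * f u + (1 - t) * f v - c / 2 * t * (1 - t) * dot (u - v) (u - v).

Definition normal_cone (R : realType) (n : nat) (C : set 'cV[R]_n)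
    (x : 'cV[R]_n) : set 'cV[R]_n :=
  [set v | C x /\ forall y, C y -> dot v (y - x) <= 0].

Definition subdifferential (R : realType) (n : nat) (K : set 'cV[R]_n)
    (q : 'cV[R]_n -> R) (x : 'cV[R]_n) : set 'cV[R]_n :=
  [set v | K x /\ forall y, K y -> q y >= q x + dot v (y - x)].

Definition phi (R : realType) (n m p : nat) (g : 'cV[R]_n -> 'cV[R]_m)
    (h : 'cV[R]_n -> 'cV[R]_p) (x : 'cV[R]_n) : R :=
  Num.max (\big[Num.max/0]_(i < m) Num.max 0 (g x i 0))
          (\big[Num.max/0]_(j < p) `|h x j 0|).

Definition feasible (R : realType) (n m p : nat) (K : set 'cV[R]_n)
    (g : 'cV[R]_n -> 'cV[R]_m) (h : 'cV[R]_n -> 'cV[R]_p)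
    : set 'cV[R]_n :=
  [set x | [/\ nonpos_orthant (g x), h x = 0 & K x]].

Definition KKT (R : realType) (n m p : nat) (K : set 'cV[R]_n)
    (f q : 'cV[R]_n -> R) (g : 'cV[R]_n -> 'cV[R]_m)
    (h : 'cV[R]_n -> 'cV[R]_p) (x : 'cV[R]_n) : Prop :=
  feasible K g h x /\
  exists (xi : 'cV[R]_m) (pi : 'cV[R]_p),
    normal_cone (@nonpos_orthant R m) (g x) xi /\
    exists v w, [/\ subdifferential K q x v, normal_cone K x w &
      0 = gradient f x + v + tjacobian g x *m xi + tjacobian h x *m pi + w].

Definition M0 (R : realType) (n m p : nat) (K : set 'cV[R]_n)
    (g : 'cV[R]_n -> 'cV[R]_m) (h : 'cV[R]_n -> 'cV[R]_p) (x : 'cV[R]_n)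
    : set ('cV[R]_m * 'cV[R]_p) :=
  [set mu | [/\ normal_cone (@nonpos_orthant R m)
                  (g x - const_mx (phi g h x)) mu.1,
                normal_cone (linf_ball (phi g h x)) (h x) mu.2 &
                exists2 w, normal_cone K x w &
                  0 = tjacobian g x *m mu.1 + tjacobian h x *m mu.2 + w]].

Definition eMFCQ (R : realType) (n m p : nat) (K : set 'cV[R]_n)
    (g : 'cV[R]_n -> 'cV[R]_m) (h : 'cV[R]_n -> 'cV[R]_p) (x : 'cV[R]_n)
    : Prop :=
  M0 K g h x = [set (0, 0)].

Definition problem_data (R : realType) (n m p : nat) (K : set 'cV[R]_n)
    (f q : 'cV[R]_n -> R) (g : 'cV[R]_n -> 'cV[R]_m)
    (h : 'cV[R]_n -> 'cV[R]_p) : Prop :=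
  [/\ [/\ K !=set0, closed K & convex_set K],
      exists U, [/\ open U, K `<=` U, C11 U f, C11_vec U g & C11_vec U h],
      convex_function K q &
      exists U, [/\ open U, K `<=` U & locally_lipschitz U q]].

Definition assumptionA (R : realType) (n : nat) (K : set 'cV[R]_n)
    (f : 'cV[R]_n -> R) (beta c : R) (Od Ox : set 'cV[R]_n)
    (ft : 'cV[R]_n -> 'cV[R]_n -> R) : Prop :=
  let ft1 (x : 'cV[R]_n) := fun d => ft d x in
  [/\ [/\ 0 < beta, sup [set `|z.1 - z.2| | z in K `*` K] < beta,
          open Od /\ linf_ball beta `<=` Od & open Ox /\ K `<=` Ox],
      forall d x, Od d -> Ox x ->
        differentiable (ft1 x) d /\ {for d, continuous (gradient (ft1 x))},
      0 < c /\ forall x, K x -> strongly_convex_on c Od (ft1 x),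
      forall d x, Od d -> Ox x ->
        {for (d, x), continuous (fun z => ft z.1 z.2)} /\
        {for (d, x), continuous (fun z => gradient (ft1 z.2) z.1)} &
      forall x, K x -> gradient (ft1 x) 0 = gradient f x].

Definition assumptionC (R : realType) (n : nat) (Od Ox : set 'cV[R]_n)
    (ft : 'cV[R]_n -> 'cV[R]_n -> R) : Prop :=
  locally_lipschitz (Od `*` Ox) (fun z => ft z.1 z.2).

Definition assumptionD (R : realType) (n m p : nat) (K : set 'cV[R]_n)
    (g : 'cV[R]_n -> 'cV[R]_m) (h : 'cV[R]_n -> 'cV[R]_p)
    (A : 'M[R]_(p, n)) (b : 'cV[R]_p) : Prop :=
  [/\ exists V, [/\ open V, K `<=` V, convex_set V,
        forall i, convex_function V (fun x => g x i 0) &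
        forall x, V x -> h x = A *m x + b],
      bounded_set K,
      feasible K g h !=set0 &
      forall x, K x -> eMFCQ K g h x].

Definition subproblem_feasible (R : realType) (n m p : nat)
    (K : set 'cV[R]_n) (g : 'cV[R]_n -> 'cV[R]_m)
    (A : 'M[R]_(p, n)) (b : 'cV[R]_p) (x : 'cV[R]_n) : set 'cV[R]_n :=
  [set d | [/\ nonpos_orthant (g x + (tjacobian g x)^T *m d),
               A *m (x + d) + b = 0 & K (x + d)]].

Definition subproblem_solution (R : realType) (n m p : nat)
    (K : set 'cV[R]_n) (q : 'cV[R]_n -> R) (g : 'cV[R]_n -> 'cV[R]_m)
    (A : 'M[R]_(p, n)) (b : 'cV[R]_p) (ft : 'cV[R]_n -> 'cV[R]_n -> R)
    (x : 'cV[R]_n) : set 'cV[R]_n :=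
  [set d | subproblem_feasible K g A b x d /\
    forall d', subproblem_feasible K g A b x d' ->
      ft d x + q (x + d) <= ft d' x + q (x + d')].

(* The infinite run from x 0: the stopping test fails at every iteration. *)
Definition simplified_DSM (R : realType) (n m p : nat)
    (K : set 'cV[R]_n) (f q : 'cV[R]_n -> R) (g : 'cV[R]_n -> 'cV[R]_m)
    (h : 'cV[R]_n -> 'cV[R]_p) (A : 'M[R]_(p, n)) (b : 'cV[R]_p)
    (ft : 'cV[R]_n -> 'cV[R]_n -> R)
    (gamma : nat -> R) (x : nat -> 'cV[R]_n) : Prop :=
  forall nu, ~ KKT K f q g h (x nu) /\
    exists2 d, subproblem_solution K q g A b ft (x nu) d &
      x nu.+1 = x nu + gamma nu *: d.

Definition limit_of_subsequence (R : realType) (n : nat)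
    (x : nat -> 'cV[R]_n) (l : 'cV[R]_n) : Prop :=
  exists2 s : nat -> nat, increasing_seq s & x \o s @ \oo --> l.

(* Main.v *)
Require Import Defs.
From HB Require Import structures.
From mathcomp Require Import all_boot all_order all_algebra.
From mathcomp Require Import all_classical all_reals all_analysis.
From mathcomp Require Import ring lra.

Set Implicit Arguments.
Unset Strict Implicit.
Unset Printing Implicit Defensive.

Import Order.TTheory GRing.Theory Num.Theory.
Import numFieldNormedType.Exports.

Local Open Scope classical_set_scope.
Local Open Scope ring_scope.

(** The proof compares each step with a cheap competitor and uses a merit
    function; KKT multipliers enter only at the very end.

    Feasibility.  Since [g] is convex and smooth and [h] is affine, a step
    [x + s d] along a feasible direction of the subproblem contracts the
    violation: [phi (x + s d) <= (1 - s) phi x + C s^2 |d|^2] ([phi_step]).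
    With step sizes tending to 0 and of infinite sum this forces
    [phi (x nu) -> 0] ([damped_sequence_le]), so limit points are feasible.

    Descent.  The eMFCQ at one feasible point excludes nonzero abnormal
    multipliers, which by a theorem of the alternative
    ([strictly_feasible_or_multiplier]) produces a Slater point for every small
    right-hand side of the equality constraint, with a common margin [r]
    ([slater]).  Moving from [x] towards such a point gives a feasible direction
    of the subproblem at [x] of length [O(phi x)]
    ([small_feasible_direction]).  The solution [d] of the subproblem does at
    least as well, and strong convexity of [ft] turns this into
    [grad f(x) . d + q (x + d) - q x <= M phi x - c/2 |d|^2]
    ([model_decrease]).  Hence the merit function [f + q + M phi] eventually
    decreases by at least [c/4 gamma |d|^2] per iteration ([merit_step]).

    Limit points.  Let [l] be a limit point.  If the directions stayed bounded
    away from 0 near [l], the path length would be controlled by the decrease of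
    the merit function, the iterates would be trapped near [l], and the infinite
    sum of the steps would drive the merit function to minus infinity
    ([short_steps_near_limit]).  So there are points of [K] arbitrarily close to
    [l] whose subproblem is solved by an arbitrarily small direction.  Passing
    to the limit in the values of the subproblems, [d = 0] is optimal at [l]
    among the strictly feasible directions of the linearized constraints
    ([zero_step_optimal]), and a second use of the alternative, with the
    eMFCQ at [l] ruling out a zero multiplier of the objective, gives the KKT
    multipliers ([KKT_of_stationary]). *)

(** * Column vectors *)

Lemma near_dist_lt (R : realType) (V : normedModType R) (x : V) e :
  0 < e -> \forall y \near x, `|x - y| < e.
Proof. by move=> e0; exact: (nbhs_ball_norm x (PosNum e0)). Qed.

Section Vectors.
Context {R : realType}.

Lemma coord_le_norm m n (M : 'M[R]_(m, n)) i j : `|M i j| <= `|M|.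
Proof.
rewrite [leRHS]/Num.norm /= mx_normrE.
exact: (le_bigmax _ (fun ij : 'I_m * 'I_n => `|M ij.1 ij.2|) (i, j)).
Qed.

Lemma norm_le_coord n (u : 'cV[R]_n) r :
  0 <= r -> (forall i, `|u i 0| <= r) -> `|u| <= r.
Proof.
move=> r0 ur; rewrite /Num.norm /= mx_normrE; apply/bigmax_leP; split=> // -[i j] _.
by rewrite (ord1 j).
Qed.

Lemma dotC n (u v : 'cV[R]_n) : dot u v = dot v u.
Proof. by apply: eq_bigr => i _; rewrite mulrC. Qed.

Lemma dotDr n (w u v : 'cV[R]_n) : dot w (u + v) = dot w u + dot w v.
Proof. by rewrite -big_split; apply: eq_bigr => i _; rewrite mxE mulrDr. Qed.

Lemma dotDl n (w u v : 'cV[R]_n) : dot (u + v) w = dot u w + dot v w.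
Proof. by rewrite -!(dotC w) dotDr. Qed.

Lemma dotZr n a (u v : 'cV[R]_n) : dot u (a *: v) = a * dot u v.
Proof. by rewrite [RHS]mulr_sumr; apply: eq_bigr => i _; rewrite mxE; ring. Qed.

Lemma dotZl n a (u v : 'cV[R]_n) : dot (a *: u) v = a * dot u v.
Proof. by rewrite -!(dotC v) dotZr. Qed.

Lemma dotNr n (u v : 'cV[R]_n) : dot u (- v) = - dot u v.
Proof. by rewrite -scaleN1r dotZr mulN1r. Qed.

Lemma dotNl n (u v : 'cV[R]_n) : dot (- u) v = - dot u v.
Proof. by rewrite -!(dotC v) dotNr. Qed.

Lemma dotBr n (w u v : 'cV[R]_n) : dot w (u - v) = dot w u - dot w v.
Proof. by rewrite dotDr dotNr. Qed.

Lemma dotBl n (w u v : 'cV[R]_n) : dot (u - v) w = dot u w - dot v w.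
Proof. by rewrite dotDl dotNl. Qed.

Lemma dot0r n (u : 'cV[R]_n) : dot u 0 = 0.
Proof. by rewrite /dot big1 // => i _; rewrite mxE mulr0. Qed.

Lemma dot0l n (u : 'cV[R]_n) : dot 0 u = 0.
Proof. by rewrite dotC dot0r. Qed.

Lemma dotE n (u v : 'cV[R]_n) : dot u v = (u^T *m v) 0 0.
Proof. by rewrite mxE; apply: eq_bigr => i _; rewrite mxE. Qed.

Lemma dot_mulmxl n m (M : 'M[R]_(n, m)) u v : dot (M *m u) v = dot u (M^T *m v).
Proof. by rewrite !dotE trmx_mul mulmxA. Qed.

Lemma dot_col_mx m p (u1 v1 : 'cV[R]_m) (u2 v2 : 'cV[R]_p) :
  dot (col_mx u1 u2) (col_mx v1 v2) = dot u1 v1 + dot u2 v2.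
Proof. by rewrite !dotE tr_col_mx mul_row_col mxE. Qed.

Lemma dot_le_norm n (u v : 'cV[R]_n) : `|dot u v| <= n%:R * (`|u| * `|v|).
Proof.
apply: le_trans (ler_norm_sum _ _ _) _.
apply: (@le_trans _ _ (\sum_(i < n) `|u| * `|v|)); last first.
  by rewrite sumr_const card_ord mulr_natl.
by apply: ler_sum => i _; rewrite normrM ler_pM // coord_le_norm.
Qed.

Lemma dot_self_ge0 n (u : 'cV[R]_n) : 0 <= dot u u.
Proof. by apply: sumr_ge0 => i _; rewrite -expr2 sqr_ge0. Qed.

(** The norm is the sup norm while strong convexity is measured by the Euclidean
    one; this comparison carries the quadratic decrease over to the former. *)
Lemma sqr_norm_le_dot n (u : 'cV[R]_n) : `|u| ^+ 2 <= dot u u.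
Proof.
have uu0 := dot_self_ge0 u.
suff : `|u| <= Num.sqrt (dot u u).
  by move=> h; rewrite -(sqr_sqrtr uu0) ler_sqr ?nnegrE ?sqrtr_ge0.
apply: norm_le_coord => [|i]; first exact: sqrtr_ge0.
rewrite -(sqrtr_sqr (u i 0)) ler_wsqrtr // /dot (bigD1 i) //= -expr2 lerDl.
by apply: sumr_ge0 => j _; rewrite -expr2 sqr_ge0.
Qed.

Lemma dot_sum_le n (u v w : 'cV[R]_n) :
  (forall i, 0 <= u i 0) -> (forall i, v i 0 <= w i 0) -> dot u v <= dot u w.
Proof. by move=> u0 vw; apply: ler_sum => i _; rewrite ler_wpM2l. Qed.

Lemma dot_gradient n (F : 'cV[R]_n -> R) x d : dot (gradient F x) d = 'd F x d.
Proof.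
rewrite {2}(matrix_sum_delta d) linear_sum; apply: eq_bigr => i _.
by rewrite big_ord1 linearZ /= mxE mulrC.
Qed.

Lemma trmx_norm m n (M : 'M[R]_(m, n)) : `|M^T| <= `|M|.
Proof.
rewrite [leLHS]/Num.norm /= mx_normrE; apply/bigmax_leP; split=> // -[i j] _.
by rewrite /= mxE coord_le_norm.
Qed.

Lemma trmx_continuous m n : continuous (@trmx R m n).
Proof.
move=> u; apply/(@cvgrPdist_le _ _ _ (nbhs u)) => e e0.
apply: filterS (near_dist_lt u e0) => v uv.
by rewrite -linearB /= (le_trans (trmx_norm _)) // ltW.
Qed.

(** Row vectors have this property already; transposition is a homeomorphism. *)
Lemma bounded_closed_compact_col n (A : set 'cV[R]_n) :
  bounded_set A -> closed A -> compact A.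
Proof.
move=> bA cA.
have -> : A = (@trmx R 1 n) @` ((@trmx R 1 n) @^-1` A).
  apply/seteqP; split=> [x Ax|_ [y Ay <-]] //=.
  by exists x^T; rewrite /= trmxK.
apply: continuous_compact; first exact/continuous_subspaceT/trmx_continuous.
apply: bounded_closed_compact; last first.
  by apply: closed_comp => // u _; exact: trmx_continuous.
case: bA => M [Mr MA]; exists M; split=> // r Mr' u Au.
by apply: le_trans (MA _ Mr' _ Au); rewrite -{1}(trmxK u) trmx_norm.
Qed.

End Vectors.

(** * Segments and directional derivatives *)
Section Segments.
Context {R : realType} {n : nat}.
Implicit Types (K : set 'cV[R]_n) (F : 'cV[R]_n -> R) (x y d : 'cV[R]_n).

Lemma segment_convE x y (s : R) : x + s *: (y - x) = s *: y + (1 - s) *: x.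
Proof. by rewrite scalerBr scalerBl scale1r addrCA. Qed.

Lemma convex_set_segment K x y s : convex_set K -> K x -> K y -> 0 <= s <= 1 ->
  K (x + s *: (y - x)).
Proof.
move=> cK Kx Ky /andP[s0 s1]; rewrite segment_convE.
have := cK y x (@Itv01 R s s0 s1).
by rewrite !inE /conv /= => /(_ Ky Kx).
Qed.

Lemma convex_function_segment K F x y s : convex_function K F -> K x -> K y ->
  0 <= s <= 1 -> F (x + s *: (y - x)) <= F x + s * (F y - F x).
Proof.
move=> cF Kx Ky /andP[s0 s1].
have -> : F x + s * (F y - F x) = s * F y + (1 - s) * F x by ring.
rewrite segment_convE.
have := cF (@Itv01 R s s0 s1) y x.
by rewrite !inE /conv /= => /(_ Ky Kx).
Qed.

Lemma segment_convex_function K F :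
  (forall x y s, K x -> K y -> 0 <= s <= 1 ->
     F (x + s *: (y - x)) <= F x + s * (F y - F x)) ->
  convex_function K F.
Proof.
move=> h t x y /set_mem Kx /set_mem Ky.
have := h y x t%:num Ky Kx; rewrite ge0 le1 => /(_ isT).
rewrite segment_convE => /le_trans; apply; rewrite le_eqVlt; apply/orP; left.
apply/eqP; change (F y + t%:num * (F x - F y) = t%:num * F x + (1 - t%:num) * F y).
ring.
Qed.

(** First-order conclusions below all come from dividing an inequality in the
    step [s] by [s] and letting [s] tend to 0; the quadratic term absorbs
    the errors of second order. *)
Lemma ge0_of_quadratic (a b : R) :
  (forall s, 0 < s <= 1 -> 0 <= s * a + s ^+ 2 * b) -> 0 <= a.
Proof.
move=> h; rewrite leNgt; apply/negP => a0.
have b1 : 0 < `|b| + 1 by rewrite ltr_wpDl.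
have bb : b <= `|b| := ler_norm b.
set s := Num.min 1 (- a / (2 * (`|b| + 1))).
have s0 : 0 < s.
  by rewrite lt_min ltr01 divr_gt0 ?oppr_gt0 // mulr_gt0.
have s1 : s <= 1 by rewrite ge_min lexx.
have sb : s * (`|b| + 1) <= - a / 2.
  rewrite -ler_pdivlMr // -mulrA -invfM.
  by rewrite ge_min lexx orbT.
have := h s; rewrite s0 s1 => /(_ isT).
rewrite expr2 -mulrA -mulrDr pmulr_rge0 //.
suff : s * b <= s * (`|b| + 1) by nra.
by rewrite ler_wpM2l ?(ltW s0) //; lra.
Qed.

Lemma ex_dir_quotient F x d e : differentiable F x -> 0 < e ->
  exists2 s, 0 < s <= e &
    `|dot (gradient F x) d - s^-1 * (F (x + s *: d) - F x)| <= e.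
Proof.
move=> dF e0; rewrite dot_gradient -deriveE //.
have /cvgrPdist_le/(_ e e0) := @diff_derivable _ _ _ F x d dF.
rewrite -/(derive F x d) => H.
have /nbhs_ballP[r /= r0 rH] := H.
set s := Num.min e (r / 2).
have s0 : 0 < s by rewrite lt_min e0 divr_gt0.
exists s; first by rewrite s0 ge_min lexx.
have := rH s; rewrite -ball_normE /= sub0r normrN gtr0_norm //.
rewrite [_ + x]addrC; apply; last by rewrite gt_eqF.
by rewrite (@le_lt_trans _ _ (r / 2)) ?ge_min ?lexx ?orbT //; lra.
Qed.

(** The quadratic slack [s ^+ 2 * b] makes the same lemma serve plain convexity
    ([b = 0]) and strong convexity. *)
Lemma gradient_dir_le F x d a b : differentiable F x ->
  (forall s, 0 < s <= 1 -> F (x + s *: d) - F x <= s * a + s ^+ 2 * b) ->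
  dot (gradient F x) d <= a.
Proof.
move=> dF Fab; rewrite -subr_ge0; apply: (@ge0_of_quadratic _ (`|b| + 1)) => e.
move=> /andP[e0 e1]; have [s /andP[s0 se]] := ex_dir_quotient d dF e0.
have := Fab s; rewrite s0 (le_trans se e1) => /(_ isT).
rewrite expr2 -mulrA -mulrDr -ler_pdivrMl // => h1 /ler_normlP[_ h2].
have h3 : s * b <= e * `|b|.
  apply: le_trans (ler_norm _) _.
  by rewrite normrM gtr0_norm // ler_wpM2r.
have : 0 <= a - dot (gradient F x) d + e * (`|b| + 1) by lra.
by move=> h; rewrite expr2 -mulrA -mulrDr mulr_ge0 // ltW.
Qed.

Lemma le_gradient_dir F x d a b : differentiable F x ->
  (forall s, 0 < s <= 1 -> s * a + s ^+ 2 * b <= F (x + s *: d) - F x) ->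
  a <= dot (gradient F x) d.
Proof.
move=> dF Fab; rewrite -lerN2.
have -> : - dot (gradient F x) d = dot (gradient (- F) x) d.
  by rewrite !dot_gradient diffN.
apply: (@gradient_dir_le _ _ _ _ (- b)) => [|s s01]; first exact: differentiableN.
by have := Fab s s01; rewrite /= !opprfctE; lra.
Qed.

End Segments.

(** * Locally Lipschitz maps *)
Section Lipschitz.
Context {R : realType} {V W : normedModType R}.

Lemma locally_lipschitz_continuous (U : set V) (F : V -> W) x :
  locally_lipschitz U F -> U x -> {for x, continuous F}.
Proof.
move=> lF Ux; have [k [B xB kF]] := lF x Ux.
apply/(@cvgrPdist_lt _ _ _ (nbhs x)) => e e0.
have k0 : 0 < `|k| + 1 by rewrite ltr_wpDl.
have e'0 : 0 < e / (`|k| + 1) by rewrite divr_gt0.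
near=> y.
have By : B y by near: y.
have /= := kF (x, y) (conj (nbhs_singleton xB) By).
move=> /le_lt_trans; apply.
apply: (@le_lt_trans _ _ ((`|k| + 1) * `|x - y|)).
  by rewrite ler_wpM2r // (le_trans (ler_norm k)) // lerDl.
rewrite -ltr_pdivlMl // mulrC.
by near: y; exact: near_dist_lt.
Unshelve. all: by end_near. Qed.

(** On a compact set a local Lipschitz condition is global, without convexity:
    near the diagonal of [K `*` K] the local constants apply, and away from it
    [|F x - F y|] is locally bounded while [|x - y|] is bounded below.
    Compactness of [K `*` K] makes one constant work for all pairs. *)
Lemma locally_lipschitz_compact (U K : set V) (F : V -> W) :
  compact K -> K `<=` U -> locally_lipschitz U F ->
  exists2 k, 0 < k & forall x y, K x -> K y -> `|F x - F y| <= k * `|x - y|.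
Proof.
move=> cK KU lF.
have /compact_near_coveringP cKK := compact_setX cK cK.
have cvr : \forall k \near +oo%R, (K `*` K) `<=`
    (fun k z => `|F z.1 - F z.2| <= k * `|z.1 - z.2|) k.
  apply: cKK => -[x y] [/= Kx Ky].
  have [xy|xy] := eqVneq x y.
    subst y; have [k [B xB kF]] := lF x (KU _ Kx).
    exists (B `*` B, [set k' | k <= k']).
      split; first by exists (B, B).
      by apply: nbhs_pinfty_ge; rewrite num_real.
    move=> -[[x' y'] k'] [/= [Bx' By'] kk'].
    apply: le_trans (kF (x', y') (conj Bx' By')) _.
    by rewrite ler_wpM2r.
  (* Off the diagonal: thirds of the distance keep the perturbed points at
     least [r] apart, and each value moves by less than 1, whence the 2 in [c]. *)
  set r := `|x - y| / 3.
  have r0 : 0 < r by rewrite divr_gt0 // normr_gt0 subr_eq0.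
  have Fx := locally_lipschitz_continuous lF (KU _ Kx).
  have Fy := locally_lipschitz_continuous lF (KU _ Ky).
  have /(@cvgrPdist_lt _ _ _ (nbhs x))/(_ 1 ltr01) Fx1 := Fx.
  have /(@cvgrPdist_lt _ _ _ (nbhs y))/(_ 1 ltr01) Fy1 := Fy.
  set c := `|F x - F y| + 2.
  set X := [set x' | `|x - x'| < r /\ `|F x - F x'| < 1].
  set Y := [set y' | `|y - y'| < r /\ `|F y - F y'| < 1].
  have xX : nbhs x X by apply: filterI Fx1; exact: near_dist_lt.
  have yY : nbhs y Y by apply: filterI Fy1; exact: near_dist_lt.
  exists (X `*` Y, [set k' | c / r <= k']).
    split; first by exists (X, Y).
    by apply: nbhs_pinfty_ge; rewrite num_real.
  move=> -[[x' y'] k'] [/= [[xx' Fxx'] [yy' Fyy']] kk'].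
  have xy3 : `|x - y| = 3 * r by rewrite /r; field.
  have d1 : r <= `|x' - y'|.
    have : `|x - y| <= `|x - x'| + `|x' - y'| + `|y - y'|.
      rewrite (_ : x - y = (x - x') + (x' - y') - (y - y')).
        by rewrite (le_trans (ler_normB _ _)) // lerD2r ler_normD.
      by rewrite subrKA opprB addrA subrK.
    lra.
  have d2 : `|F x' - F y'| <= c.
    rewrite (_ : F x' - F y' = - (F x - F x') + (F x - F y) + (F y - F y')).
      rewrite (le_trans (ler_normD _ _)) // (le_trans (lerD (ler_normD _ _) (lexx _))) //.
      rewrite normrN /c; lra.
    by rewrite opprB !addrA !subrK.
  apply: le_trans d2 _; have -> : c = c / r * r by rewrite divfK // gt_eqF.
  apply: (@ler_pM) => //; last exact: ltW.
  by rewrite divr_ge0 ?(ltW r0) // /c; have := normr_ge0 (F x - F y); lra.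
have [M [Mr HM]] := cvr.
exists (Num.max (M + 1) 1); first by rewrite lt_max ltr01 orbT.
move=> x y Kx Ky; apply: (HM _ _ (x, y)) => //.
by rewrite lt_max ltrDl ltr01.
Qed.

End Lipschitz.

(** * Limits of matrix expressions and smooth functions *)
Lemma addrCK (V : zmodType) (x v : V) : x + v - x = v.
Proof. by rewrite addrAC subrr add0r. Qed.

Section Limits.
Context {R : realType}.

Lemma cvg_dot T (F : set_system T) {FF : Filter F} n (u v : T -> 'cV[R]_n)
    (a b : 'cV[R]_n) :
  (forall i, u t i 0 @[t --> F] --> a i 0) ->
  (forall i, v t i 0 @[t --> F] --> b i 0) ->
  dot (u t) (v t) @[t --> F] --> dot a b.
Proof.
move=> ua vb; apply: cvg_big => [|i _]; last exact: cvgM.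
by move=> z; apply: cvgD; [exact: cvg_fst|exact: cvg_snd].
Qed.

Lemma cvg_coord T (F : set_system T) {FF : Filter F} m n (u : T -> 'M[R]_(m, n))
    (a : 'M[R]_(m, n)) i j :
  u @ F --> a -> u t i j @[t --> F] --> a i j.
Proof. by move=> ua; exact: cvg_comp ua (@coord_continuous _ _ _ i j a). Qed.

Lemma cvg_mulmx T (F : set_system T) {FF : Filter F} m n (M : T -> 'M[R]_(m, n)) 
   (u : T -> 'cV[R]_n) (a : 'M[R]_(m, n)) (b : 'cV[R]_n) j :
  M @ F --> a -> u @ F --> b -> (M t *m u t) j 0 @[t --> F] --> (a *m b) j 0.
Proof.
move=> Ma ub.
have dotrow (A : 'M[R]_(m, n)) v : (A *m v) j 0 = dot (\col_k A j k) v.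
  by rewrite mxE; apply: eq_bigr => k _; rewrite mxE.
rewrite dotrow; under eq_cvg do rewrite dotrow.
apply: cvg_dot => i; last exact: cvg_coord.
rewrite mxE; under eq_cvg do rewrite mxE.
exact: cvg_coord.
Qed.

End Limits.

Section Smooth.
Context {R : realType} {n : nat}.
Implicit Types (K : set 'cV[R]_n) (F : 'cV[R]_n -> R) (x y d : 'cV[R]_n).

Lemma convex_gradient_le K F x y : convex_function K F -> differentiable F x ->
  K x -> K y -> dot (gradient F x) (y - x) <= F y - F x.
Proof.
move=> cF dF Kx Ky; apply: (@gradient_dir_le _ _ _ _ _ _ 0) => // s /andP[s0 s1].
rewrite mulr0 addr0 lerBlDl.
by apply: (convex_function_segment cF Kx Ky); rewrite (ltW s0).
Qed.

Lemma is_derive_line F x d t : differentiable F (x + t *: d) ->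
  is_derive t (1 : R) (fun t => F (x + t *: d)) (dot (gradient F (x + t *: d)) d).
Proof.
move=> dF; rewrite dot_gradient -deriveE //.
have E : (fun h : R => h^-1 *: (((fun t => F (x + t *: d)) \o shift t) (h *: 1) -
                                F (x + t *: d))) =
         (fun h : R => h^-1 *: ((F \o shift (x + t *: d)) (h *: d) -
                                F (x + t *: d))).
  apply/funext => h /=; congr (_ *: (F _ - _)).
  by rewrite [h *: 1]mulr1 scalerDl addrCA.
have := @diff_derivable _ _ _ F (x + t *: d) d dF.
move=> dd; apply: DeriveDef; first by rewrite /derivable E.
by rewrite /derive E.
Qed.

Let quadratic_remainder (N L e a b s D D0 : R) : 0 <= s ->
  a - b = D * s -> D - D0 <= N * (L * (s * e) * e) ->
  a <= b + s * D0 + N * L * s ^+ 2 * e ^+ 2.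
Proof.
set B := N * (L * (s * e) * e) => s0 ab DB.
have -> : N * L * s ^+ 2 * e ^+ 2 = B * s by rewrite /B; ring.
have -> : a = b + D * s by rewrite -ab; ring.
have : (D - D0) * s <= B * s by rewrite ler_wpM2r.
lra.
Qed.

(** Mean value theorem on the segment, followed by the Lipschitz bound on the
    gradient; the factor [n] comes from bounding the inner product by sup norms. *)
Lemma descent_inequality K F L x d s : convex_set K ->
  (forall y, K y -> differentiable F y) ->
  (forall y z, K y -> K z -> `|gradient F y - gradient F z| <= L * `|y - z|) ->
  K x -> K (x + d) -> 0 <= s <= 1 ->
  F (x + s *: d) <= F x + s * dot (gradient F x) d + n%:R * L * s ^+ 2 * `|d| ^+ 2.
Proof.
move=> cK dF lF Kx Kxd /andP[s0 s1].
have Kt t : 0 <= t <= 1 -> K (x + t *: d).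
  by move=> t01; have := convex_set_segment cK Kx Kxd t01; rewrite addrAC subrr add0r.
have dt t : 0 <= t <= s -> is_derive t (1 : R) (fun t => F (x + t *: d))
    (dot (gradient F (x + t *: d)) d).
  move=> /andP[t0 ts]; apply: is_derive_line; apply: dF; apply: Kt.
  by rewrite t0 (le_trans ts).
have [||c] := @MVT_segment _ (fun t => F (x + t *: d))
    (fun t => dot (gradient F (x + t *: d)) d) 0 s s0.
- by move=> t; rewrite in_itv /= => /andP[t0 ts]; apply: dt; rewrite !ltW.
- apply: derivable_within_continuous => t; rewrite in_itv /= => /dt[].
  by [].
rewrite in_itv /= scale0r addr0 subr0 => /andP[c0 cs] Fs.
have c01 : 0 <= c <= 1 by rewrite c0 (le_trans cs).
have := dot_le_norm (gradient F (x + c *: d) - gradient F x) d.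
rewrite dotBl => /ler_normlP[_ h1].
have h2 := lF _ _ (Kt _ c01) Kx.
rewrite addrCK normrZ ger0_norm // in h2.
have h3 : n%:R * (`|gradient F (x + c *: d) - gradient F x| * `|d|) <=
          n%:R * (L * (s * `|d|) * `|d|).
  have L0 : 0 <= L * `|d|.
    by have := lF _ _ Kxd Kx; rewrite addrCK; apply: le_trans.
  rewrite ler_wpM2l // ler_wpM2r // (le_trans h2) // mulrCA [leRHS]mulrCA.
  by rewrite ler_wpM2r.
have h4 := le_trans h1 h3.
exact: quadratic_remainder s0 Fs h4.
Qed.

(** This links the columnwise definition of the transposed Jacobian to the
    differential, so that pairings with [g] can be differentiated by the chain
    rule. *)
Lemma diff_tjacobian m (g : 'cV[R]_n -> 'cV[R]_m) x d :
  ('d g x d : 'cV[R]_m) = (tjacobian g x)^T *m d.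
Proof.
have -> : 'd g x d = 'd g x (\sum_i \sum_j d i j *: delta_mx i j).
  by rewrite -matrix_sum_delta.
rewrite (linear_sum ('d g x)).
apply/colP => j; rewrite summxE [RHS]mxE; apply: eq_bigr => i _.
rewrite big_ord1 (linearZ_LR ('d g x)) !mxE mulrC.
by [].
Qed.

Let dot_comp m (g : 'cV[R]_n -> 'cV[R]_m) (xi : 'cV[R]_m) x d :
  differentiable g x -> differentiable (fun y => dot xi (g y)) x /\
  dot (gradient (fun y => dot xi (g y)) x) d = dot xi ((tjacobian g x)^T *m d).
Proof.
move=> dg.
have dot_lin : linear (fun v : 'cV[R]_m => dot xi v : R^o).
  by move=> a u v; rewrite dotDr dotZr.
pose dotL : {linear 'cV[R]_m -> R^o} :=
  HB.pack (fun v : 'cV[R]_m => dot xi v : R^o)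
    (GRing.isLinear.Build _ _ _ _ _ dot_lin).
have dot_cont : continuous dotL.
  move=> v; apply: (@cvg_dot _ _ (nbhs v)) => i; first exact: cvg_cst.
  exact: coord_continuous.
have ddot : differentiable (fun v : 'cV[R]_m => dot xi v) (g x).
  exact: linear_differentiable dot_cont.
split; first exact: (@differentiable_comp _ _ _ _ g (fun v => dot xi v)).
rewrite dot_gradient (@diff_comp _ _ _ _ g (fun v => dot xi v)) //= -diff_tjacobian.
exact: (congr1 (fun L => L _) (@diff_lin _ _ _ dotL (g x) dot_cont)).
Qed.

Lemma differentiable_dot m (g : 'cV[R]_n -> 'cV[R]_m) xi x :
  differentiable g x -> differentiable (fun y => dot xi (g y)) x.
Proof. by move=> dg; have [] := dot_comp xi 0 dg. Qed.

Lemma gradient_dot m (g : 'cV[R]_n -> 'cV[R]_m) xi x d : differentiable g x ->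
  dot (gradient (fun y => dot xi (g y)) x) d = dot xi ((tjacobian g x)^T *m d).
Proof. by move=> dg; have [] := dot_comp xi d dg. Qed.

Let dot_delta m (v : 'cV[R]_m) j : v j 0 = dot (delta_mx j 0) v.
Proof.
rewrite /dot (bigD1 j) //= mxE !eqxx mul1r big1 ?addr0 // => i ij.
by rewrite mxE (negbTE ij) mul0r.
Qed.

Lemma differentiable_component m (g : 'cV[R]_n -> 'cV[R]_m) x j :
  differentiable g x -> differentiable (fun y => g y j 0) x.
Proof.
move=> dg; rewrite (_ : (fun y => _) = (fun y => dot (delta_mx j 0) (g y))).
  exact: differentiable_dot.
by apply/funext => y; rewrite dot_delta.
Qed.

Lemma dot_gradient_component m (g : 'cV[R]_n -> 'cV[R]_m) x j d :
  differentiable g x ->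
  dot (gradient (fun y => g y j 0) x) d = ((tjacobian g x)^T *m d) j 0.
Proof.
move=> dg; have -> : (fun y => g y j 0) = (fun y => dot (delta_mx j 0) (g y)).
  by apply/funext => y; exact: dot_delta.
by rewrite (gradient_dot _ _ dg) (dot_delta (_ *m d)).
Qed.

Lemma compact_lower_bound K F : compact K ->
  (forall x, K x -> {for x, continuous F}) -> exists c, forall x, K x -> c <= F x.
Proof.
move=> cK cF; have [->|/set0P K0] := eqVneq K set0; first by exists 0.
have [|c _ cP] := compact_EVT_min K0 cK (f := F).
  by apply: continuous_in_subspaceT => x /set_mem /cF.
by exists (F c) => x /mem_set /cP.
Qed.

End Smooth.

(** * A theorem of the alternative for convex systems *)
Section Infeasibility.
Context {R : realType}.

Lemma cluster_closed (T : topologicalType) (F : set_system T) (C : set T) x :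
  closed C -> F C -> cluster F x -> C x.
Proof. by move=> /closure_id cC FC; rewrite clusterE => /(_ C FC); rewrite -cC. Qed.

Lemma dot_self_line n (a v : 'cV[R]_n) s :
  dot (a + s *: v) (a + s *: v) = dot a a + 2 * s * dot a v + s ^+ 2 * dot v v.
Proof. by rewrite !(dotDl, dotDr, dotZl, dotZr) (dotC v a); ring. Qed.

Section Data.
Context {n m p : nat}.
Variables (K : set 'cV[R]_n) (A : 'M[R]_(p, n)) (b : 'cV[R]_p).
Hypotheses (K0 : K !=set0) (cK : compact K) (convK : convex_set K).

(** Minimize the squared violation [|u_+|^2 + |A y + b|^2] over the compact set
    [K].  At a minimizer [y0] the residual [(u_+ y0, A y0 + b)] is nonzero and
    serves as the multiplier: first-order optimality says that the inner
    product of [(u y, A y + b)] with it is, for every [y] in [K], at least the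
    square of the residual. *)
Lemma infeasible_multiplier (u : 'cV[R]_n -> 'cV[R]_m) :
  (forall i, convex_function K (fun y => u y i 0)) ->
  (forall i x, K x -> {for x, continuous (fun y => u y i 0)}) ->
  (forall y, K y -> (forall i, u y i 0 <= 0) -> A *m y + b = 0 -> False) ->
  exists (xi : 'cV[R]_m) (pi : 'cV[R]_p), [/\ (xi, pi) <> (0, 0), forall i, 0 <= xi i 0 &
    forall y, K y -> 0 <= dot xi (u y) + dot pi (A *m y + b)].
Proof.
move=> convu contu infeas.
pose up y : 'cV[R]_m := \col_i Num.max 0 (u y i 0).
pose H y : 'cV[R]_p := A *m y + b.
pose Phi y := dot (up y) (up y) + dot (H y) (H y).
have contPhi x : K x -> {for x, continuous Phi}.
  move=> Kx; have H1 i : up y i 0 @[y --> nbhs x] --> up x i 0.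
    rewrite mxE; under eq_cvg do rewrite mxE.
    apply: (@continuous_max R _ (cst 0) (fun y => u y i 0) x); last exact: contu.
    exact: cst_continuous.
  have H2 i : H y i 0 @[y --> nbhs x] --> H x i 0.
    rewrite mxE; under eq_cvg do rewrite mxE.
    apply: cvgD; last exact: cvg_cst.
    apply: (@cvg_mulmx _ _ _ _ _ _ (fun=> A) id); first exact: cvg_cst.
    exact: cvg_id.
  by apply: (@cvgD _ _ _ (nbhs x)); exact: (@cvg_dot _ _ (nbhs x)).
have [|y0 /set_mem Ky0 y0min] := compact_EVT_min K0 cK (f := Phi).
  by apply: continuous_in_subspaceT => x /set_mem /contPhi.
exists (up y0), (H y0); split.
- move=> [up0 H0]; apply: (infeas y0) => // i.
  have := congr1 (fun v : 'cV[R]_m => v i 0) up0; rewrite !mxE => <-.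
  by rewrite le_max lexx orbT.
- by move=> i; rewrite mxE le_max lexx.
move=> y Ky.
set v := u y - up y0; set w := H y - H y0.
have : 0 <= dot (up y0) v + dot (H y0) w.
  apply: (@ge0_of_quadratic _ _ ((dot v v + dot w w) / 2)) => s /andP[s0 s1].
  have s01 : 0 <= s <= 1 by rewrite (ltW s0).
  set ys := y0 + s *: (y - y0).
  have Kys : K ys by exact: convex_set_segment.
  have Hys : H ys = H y0 + s *: w.
    by rewrite /H /w /H /ys mulmxDr -scalemxAr mulmxBr addrAC opprD addrACA subrr addr0.
  have upys : dot (up ys) (up ys) <= dot (up y0 + s *: v) (up y0 + s *: v).
    apply: ler_sum => i _; rewrite -!expr2.
    have uv : u ys i 0 <= (up y0 + s *: v) i 0.
      rewrite (le_trans (convex_function_segment (convu i) Ky0 Ky s01)) //.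
      rewrite !mxE; set M := Num.max _ _.
      have : u y0 i 0 <= M by rewrite le_max lexx orbT.
      nra.
    rewrite [up ys i 0]mxE.
    have [_|u0] := leP (u ys i 0) 0; first by rewrite expr0n /= sqr_ge0.
    by rewrite ler_sqr // nnegrE ?(ltW u0) // (le_trans (ltW u0)).
  have := y0min _ (mem_set Kys).
  rewrite /Phi Hys => h.
  have := le_trans h (lerD upys (lexx _)).
  rewrite !dot_self_line; lra.
rewrite !dotBr; have := dot_self_ge0 (up y0); have := dot_self_ge0 (H y0).
rewrite /H; lra.
Qed.

End Data.
End Infeasibility.

Section Alternative.
Context {R : realType}.

Lemma linf_ball_compact n r : compact (@linf_ball R n r).
Proof.
apply: bounded_closed_compact_col.
  exists r; split; first exact: num_real.
  by move=> r' rr' x /= xr; rewrite (le_trans xr) // ltW.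
have -> : linf_ball r = (@Num.norm R 'cV[R]_n) @^-1` [set t | t <= r] by [].
apply: closed_comp; last exact: closed_le.
by move=> x _; exact: norm_continuous.
Qed.

Lemma unit_sphere_compact m p :
  compact [set a : 'cV[R]_m * 'cV[R]_p | `|a| = 1].
Proof.
apply: (@subclosed_compact _ _ (linf_ball 1 `*` linf_ball 1)).
- have -> : [set a : 'cV[R]_m * 'cV[R]_p | `|a| = 1] =
      Num.norm @^-1` [set 1] by [].
  apply: closed_comp; last exact: closed_eq.
  by move=> x _; exact: norm_continuous.
- by apply: compact_setX; exact: linf_ball_compact.
- move=> [a1 a2] /=; rewrite prod_normE /= /linf_ball /= => na.
  by rewrite -na !le_max !lexx orbT.
Qed.

Section Data.
Context {n m p : nat}.
Variables (K : set 'cV[R]_n) (A : 'M[R]_(p, n)) (b : 'cV[R]_p).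
Hypotheses (K0 : K !=set0) (cK : compact K) (convK : convex_set K).

(** Shifting the constraints by [r] and [z] turns the failure of strict
    feasibility with margin [r] into infeasibility.  Normalization keeps the
    multipliers in a compact set, at the price of an error of order [r] only. *)
Let normalized_multiplier (u : 'cV[R]_n -> 'cV[R]_m) r z :
  (forall i, convex_function K (fun y => u y i 0)) ->
  (forall i x, K x -> {for x, continuous (fun y => u y i 0)}) ->
  `|z| <= r ->
  ~ (exists y, [/\ K y, forall i, u y i 0 <= - r & A *m y + b = z]) ->
  exists a : 'cV[R]_m * 'cV[R]_p, [/\ `|a| = 1, forall i, 0 <= a.1 i 0 &
    forall y, K y -> - (r * (m%:R + p%:R)) <= dot a.1 (u y) + dot a.2 (A *m y + b)].
Proof.
move=> convu contu zr infeas.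
have r0 : 0 <= r := le_trans (normr_ge0 z) zr.
have [|||xi [pi [xipi0 xi0 xipi]]] :=
  @infeasible_multiplier _ n m p K A (b - z) K0 cK convK (fun y => u y + const_mx r).
- move=> i; apply: segment_convex_function => x y s Kx Ky s01.
  by rewrite !mxE; have := convex_function_segment (convu i) Kx Ky s01; lra.
- move=> i x Kx; rewrite (_ : (fun y => _) = (fun y => u y i 0 + r)); last first.
    by apply/funext => y; rewrite !mxE.
  by apply: (@cvgD _ _ _ (nbhs x)); [exact: contu|exact: cvg_cst].
- move=> y Ky uy Hy; apply: infeas; exists y; split=> // [i|].
    by have := uy i; rewrite !mxE; lra.
  by move/eqP: Hy; rewrite addrA subr_eq0 => /eqP.
pose N := `|(xi, pi)|.
have N0 : 0 < N by rewrite normr_gt0; apply/eqP.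
exists (N^-1 *: xi, N^-1 *: pi).
have a1 : `|(N^-1 *: xi, N^-1 *: pi)| = 1.
  have -> : (N^-1 *: xi, N^-1 *: pi) = N^-1 *: (xi, pi) by [].
  by rewrite normrZ gtr0_norm ?invr_gt0 // mulVf // gt_eqF.
split=> // [i|y Ky]; first by rewrite mxE mulr_ge0 // invr_ge0 ltW.
have /andP[b1 b2] : (`|N^-1 *: xi| <= 1) && (`|N^-1 *: pi| <= 1).
  by move: a1; rewrite prod_normE /= => <-; rewrite !le_max !lexx orbT.
rewrite /=.
have h : 0 <= dot (N^-1 *: xi) (u y + const_mx r) + dot (N^-1 *: pi) (A *m y + (b - z)).
  by rewrite !dotZl -mulrDr mulr_ge0 // ?invr_ge0 ?(ltW N0) // xipi.
move: h; rewrite addrA dotBr dotDr.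
have rr : `|const_mx r : 'cV[R]_m| <= r.
  by apply: norm_le_coord => // i; rewrite mxE ger0_norm.
have h1 : dot (N^-1 *: xi) (const_mx r) <= m%:R * r.
  have /ler_normlP[_ h] := dot_le_norm (N^-1 *: xi) (const_mx r).
  by rewrite (le_trans h) // ler_wpM2l // -[leRHS]mul1r ler_pM.
have h2 : - dot (N^-1 *: pi) z <= p%:R * r.
  have /ler_normlP[h _] := dot_le_norm (N^-1 *: pi) z.
  by rewrite (le_trans h) // ler_wpM2l // -[leRHS]mul1r ler_pM.
lra.
Qed.

(** If every margin fails, the unit multipliers obtained for the margins
    [1/(k+1)] have a cluster point, at which the error terms have disappeared.
    Perturbing the equality constraint as well as the inequalities is what makes
    the first alternative an interiority statement. *)
Lemma strictly_feasible_or_multiplier (u : 'cV[R]_n -> 'cV[R]_m) :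
  (forall i, convex_function K (fun y => u y i 0)) ->
  (forall i x, K x -> {for x, continuous (fun y => u y i 0)}) ->
  (exists2 r, 0 < r & forall z, `|z| <= r ->
     exists y, [/\ K y, forall i, u y i 0 <= - r & A *m y + b = z]) \/
  exists (xi : 'cV[R]_m) (pi : 'cV[R]_p), [/\ (xi, pi) <> (0, 0),
    forall i, 0 <= xi i 0 &
    forall y, K y -> 0 <= dot xi (u y) + dot pi (A *m y + b)].
Proof.
move=> convu contu.
have [|nr] := pselect (exists2 r, 0 < r & forall z, `|z| <= r ->
    exists y, [/\ K y, forall i, u y i 0 <= - r & A *m y + b = z]).
  by left.
right; pose r (k : nat) : R := k.+1%:R^-1.
have /choice[a aP] : forall k, exists a : 'cV[R]_m * 'cV[R]_p,
    [/\ `|a| = 1, forall i, 0 <= a.1 i 0 & forall y, K y ->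
      - (r k * (m%:R + p%:R)) <= dot a.1 (u y) + dot a.2 (A *m y + b)].
  move=> k; have rk0 : 0 < r k by rewrite invr_gt0.
  have /existsNP[z /not_implyP[zr nex]] : ~ (forall z, `|z| <= r k ->
      exists y, [/\ K y, forall i, u y i 0 <= - r k & A *m y + b = z]).
    by move=> h; apply: nr; exists (r k).
  exact: normalized_multiplier nex.
have [|a0 [/= na0 cla]] := @unit_sphere_compact m p (a @ \oo) _.
  by exists 0%N => // k _ /=; have [] := aP k.
have evt (C : set ('cV[R]_m * 'cV[R]_p)) : closed C ->
    (\forall k \near \oo, C (a k)) -> C a0.
  by move=> cC Ca; apply: cluster_closed cla.
exists a0.1, a0.2; split.
- move=> a00; have : a0 = 0 by rewrite [LHS]surjective_pairing a00.
  by move=> a0E; move: na0; rewrite a0E normr0 => /esym/eqP; rewrite oner_eq0.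
- move=> i; suff : [set a : 'cV[R]_m * 'cV[R]_p | 0 <= a.1 i 0] a0 by [].
  apply: evt; last first.
    by near=> k => /=; have [] := aP k.
  have -> : [set a : 'cV[R]_m * 'cV[R]_p | 0 <= a.1 i 0] =
    (fun a : 'cV[R]_m * 'cV[R]_p => a.1 i 0) @^-1` [set t | 0 <= t] by [].
  apply: closed_comp; last exact: closed_ge.
  move=> x _; apply: (@cvg_coord _ _ (nbhs x)); exact: cvg_fst.
- move=> y Ky; apply/ler_addgt0Pr => e e0; rewrite -lerBlDr sub0r.
  suff : [set a : 'cV[R]_m * 'cV[R]_p |
      - e <= dot a.1 (u y) + dot a.2 (A *m y + b)] a0 by [].
  apply: evt.
    have -> : [set a : 'cV[R]_m * 'cV[R]_p |
        - e <= dot a.1 (u y) + dot a.2 (A *m y + b)] =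
      (fun a : 'cV[R]_m * 'cV[R]_p =>
        dot a.1 (u y) + dot a.2 (A *m y + b)) @^-1` [set t | - e <= t].
      by [].
    apply: closed_comp; last exact: closed_ge.
    move=> x _; apply: (@cvgD _ _ _ (nbhs x)); apply: (@cvg_dot _ _ (nbhs x)) => i;
      try exact: cvg_cst.
      by apply: (@cvg_coord _ _ (nbhs x)); exact: cvg_fst.
    by apply: (@cvg_coord _ _ (nbhs x)); exact: cvg_snd.
  have mp0 : 0 < m%:R + p%:R + 1 :> R by rewrite ltr_wpDl // addr_ge0.
  apply: filterS (near_infty_natSinv_lt (PosNum (divr_gt0 e0 mp0))) => k /= rk.
  have [_ _ /(_ y Ky)] := aP k; apply: le_trans; rewrite lerN2.
  move: rk; rewrite ltr_pdivlMr // => /ltW h; apply: le_trans h.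
  by rewrite ler_wpM2l ?invr_ge0 // lerDl.
Unshelve. all: by end_near. Qed.

End Data.
End Alternative.

(** * Constraint qualification and optimality *)
Section Optimality.
Context {R : realType} {n m p : nat}.
Variables (K : set 'cV[R]_n) (f q : 'cV[R]_n -> R) (g : 'cV[R]_n -> 'cV[R]_m).
Variables (h : 'cV[R]_n -> 'cV[R]_p) (A : 'M[R]_(p, n)) (b : 'cV[R]_p).
Hypothesis convK : convex_set K.
Hypothesis diffg : forall x, K x -> differentiable g x.
Hypothesis diffh : forall x, K x -> differentiable h x.
Hypothesis convg : forall i, convex_function K (fun x => g x i 0).
Hypothesis affh : forall x, K x -> h x = A *m x + b.

Lemma phi_ge0 x : 0 <= phi g h x.
Proof. by rewrite le_max bigmax_ge_id. Qed.

Lemma phi_le x r :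
  0 <= r -> (forall i, g x i 0 <= r) -> `|h x| <= r -> phi g h x <= r.
Proof.
move=> r0 gr hr; rewrite ge_max; apply/andP; split; apply: bigmax_le => // i _.
  by rewrite ge_max r0 gr.
exact: le_trans (coord_le_norm _ _ _) hr.
Qed.

Lemma le_phi_g x i : g x i 0 <= phi g h x.
Proof.
rewrite le_max; apply/orP; left.
apply: (@le_trans _ _ (Num.max 0 (g x i 0))); first by rewrite le_max lexx orbT.
exact: (le_bigmax _ (fun i => Num.max 0 (g x i 0)) i).
Qed.

Lemma le_phi_h x : `|h x| <= phi g h x.
Proof.
apply: norm_le_coord => [|j]; first exact: phi_ge0.
rewrite le_max; apply/orP; right.
exact: (le_bigmax _ (fun j => `|h x j 0|) j).
Qed.

Lemma phi_feasible x : feasible K g h x -> phi g h x = 0.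
Proof.
move=> [gx hx _]; apply/eqP; rewrite eq_le phi_ge0 andbT.
by apply: phi_le; rewrite // hx normr0.
Qed.

(** Convexity of [g]: points satisfying [g <= 0] also satisfy the linearized
    constraints, so the subproblem inherits feasible points of the problem. *)
Lemma linearization_le x y i : K x -> K y ->
  (g x + (tjacobian g x)^T *m (y - x)) i 0 <= g y i 0.
Proof.
move=> Kx Ky; rewrite mxE -lerBrDl -dot_gradient_component; last exact: diffg.
apply: (convex_gradient_le (convg i)) => //.
by apply: differentiable_component; exact: diffg.
Qed.

Lemma tjacobian_affine x y : K x -> K y ->
  (tjacobian h x)^T *m (y - x) = A *m (y - x).
Proof.
move=> Kx Ky; apply/colP => j.
rewrite -dot_gradient_component; last exact: diffh.
have dhj : differentiable (fun z => h z j 0) x.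
  by apply: differentiable_component; exact: diffh.
have hs s : 0 < s <= 1 -> h (x + s *: (y - x)) j 0 - h x j 0 = s * (A *m (y - x)) j 0.
  move=> /andP[s0 s1]; rewrite affh; last first.
    by apply: convex_set_segment => //; rewrite (ltW s0).
  by rewrite affh // mulmxDr -scalemxAr !mxE; ring.
apply/eqP; rewrite eq_le; apply/andP; split.
  by apply: (@gradient_dir_le _ _ _ _ _ _ 0) => // s s01; rewrite mulr0 addr0 hs.
by apply: (@le_gradient_dir _ _ _ _ _ _ 0) => // s s01; rewrite mulr0 addr0 hs.
Qed.

(** A pair making the Lagrangian of the constraints nonnegative on [K] makes the
    feasible point [x] a minimizer of that Lagrangian, with value 0; its
    first-order condition over [K] is the inclusion defining [M0].  At a feasible
    point [phi] vanishes, so the cones in [M0] are the usual complementarity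
    condition and the whole space. *)
Lemma multiplier_in_M0 x (xi : 'cV[R]_m) (pi : 'cV[R]_p) : feasible K g h x ->
  (forall i, 0 <= xi i 0) ->
  (forall y, K y -> 0 <= dot xi (g y) + dot pi (h y)) ->
  M0 K g h x (xi, pi).
Proof.
move=> Fx xi0 xipi; have [gx hx Kx] := Fx.
have xig : dot xi (g x) = 0.
  apply/eqP; rewrite eq_le; apply/andP; split.
    by rewrite -(dot0r xi); apply: dot_sum_le => // i; rewrite [leRHS]mxE.
  by have := xipi x Kx; rewrite hx dot0r addr0.
split; rewrite /= ?(phi_feasible Fx).
- have -> : const_mx 0 = 0 :> 'cV[R]_m by apply/colP => i; rewrite !mxE.
  rewrite subr0; split=> // y y0; rewrite dotBr xig subr0.
  by rewrite -(dot0r xi); apply: dot_sum_le => // i; rewrite [leRHS]mxE.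
- rewrite hx; split=> [|y]; first by rewrite /linf_ball /= normr0.
  by rewrite /linf_ball /= normr_le0 => /eqP ->; rewrite subrr dot0r.
- exists (- (tjacobian g x *m xi + tjacobian h x *m pi)); last by rewrite subrr.
  split=> // y Ky; rewrite dotNl oppr_le0 dotDl !dot_mulmxl.
  have dg := diffg Kx; have dh := diffh Kx.
  have dxi := differentiable_dot xi dg; have dpi := differentiable_dot pi dh.
  rewrite -(gradient_dot xi _ dg) -(gradient_dot pi _ dh) !dot_gradient.
  have -> : 'd (fun y => dot xi (g y)) x (y - x) + 'd (fun y => dot pi (h y)) x (y - x)
      = 'd ((fun y => dot xi (g y)) + (fun y => dot pi (h y))) x (y - x).
    by rewrite diffD.
  rewrite -dot_gradient; apply: (@le_gradient_dir _ _ _ _ _ _ 0).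
    exact: differentiableD.
  move=> s /andP[s0 s1]; rewrite !mulr0 addr0 /= !addrfctE xig hx dot0r.
  rewrite addr0 subr0; apply: xipi; apply: convex_set_segment => //.
  by rewrite (ltW s0).
Qed.

Hypothesis cK : compact K.

(** Under the eMFCQ the second alternative would put a nonzero pair in [M0].  The
    margin is uniform over a ball of right-hand sides, which is what allows the
    violation of the equality constraint to be corrected proportionally. *)
Lemma slater x : feasible K g h x -> eMFCQ K g h x ->
  exists2 r, 0 < r & forall z, `|z| <= r ->
     exists y, [/\ K y, forall i, g y i 0 <= - r & A *m y + b = z].
Proof.
move=> Fx qual; have [gx hx Kx] := Fx.
have K0 : K !=set0 by exists x.
have [| |//|[xi [pi [xipi0 xi0 xipi]]]] :=
  @strictly_feasible_or_multiplier _ n m p K A b K0 cK convK g.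
- exact: convg.
- move=> i y Ky; apply: differentiable_continuous.
  by apply: differentiable_component; exact: diffg.
have : M0 K g h x (xi, pi).
  by apply: multiplier_in_M0 => // y Ky; rewrite affh //; exact: xipi.
by rewrite qual.
Qed.

Hypothesis convq : convex_function K q.
Hypothesis contq : forall x, K x -> {for x, continuous q}.

(** The alternative is applied to the system made of the linearized objective [P]
    and the linearized constraints [G].  Stationarity excludes a strictly feasible
    point, so there are multipliers [(tau, xi, pi)].  If [tau] were 0, [(xi, pi)]
    would lie in [M0], because [G] lies below [g].  After division by [tau] the
    Lagrangian inequality itself says that a vector is a subgradient of [q]
    relative to [K]; since that subdifferential already absorbs [K], the normal
    vector can be taken to be 0. *)
Lemma KKT_of_stationary x : feasible K g h x -> eMFCQ K g h x ->
  (forall y, K y -> (forall i, (g x + (tjacobian g x)^T *m (y - x)) i 0 < 0) ->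
     A *m y + b = 0 -> 0 <= dot (gradient f x) (y - x) + (q y - q x)) ->
  KKT K f q g h x.
Proof.
move=> Fx qual stat; have [gx hx Kx] := Fx.
have K0 : K !=set0 by exists x.
pose P y := dot (gradient f x) (y - x) + (q y - q x).
pose G y := g x + (tjacobian g x)^T *m (y - x).
pose u y : 'cV[R]_(1 + m) := col_mx (const_mx (P y)) (G y).
have uP y i : u y (lshift m i) 0 = P y by rewrite col_mxEu mxE.
have uG y i : u y (rshift 1 i) 0 = G y i 0 by rewrite col_mxEd.
have convu i : convex_function K (fun y => u y i 0).
  apply: segment_convex_function => y z s Ky Kz s01.
  have yzx : y + s *: (z - y) - x = (y - x) + s *: (z - x - (y - x)).
    by rewrite opprB addrA subrK addrAC.
  case: (split_ordP i) => j ->; rewrite !(uP, uG).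
    rewrite /P yzx dotDr dotZr (dotBr _ (z - x)).
    have := convex_function_segment convq Ky Kz s01; lra.
  rewrite /G yzx mulmxDr -scalemxAr (mulmxBr _ (z - x)) !mxE; lra.
have contx y : K y -> (fun y => y - x) @ nbhs y --> (y - x).
  by move=> Ky; apply: cvgB; [exact: cvg_id|exact: cvg_cst].
have contu i y : K y -> {for y, continuous (fun y => u y i 0)}.
  move=> Ky; case: (split_ordP i) => j ->.
    rewrite (_ : (fun y => _) = P); last exact/funext.
    apply: (@cvgD _ _ _ (nbhs y)); last first.
      by apply: (@cvgB _ _ _ (nbhs y)); [exact: contq|exact: cvg_cst].
    apply: (@cvg_dot _ _ (nbhs y)) => k; first exact: cvg_cst.
    by apply: (@cvg_coord _ _ (nbhs y)); exact: contx.
  rewrite (_ : (fun y => _) = (fun y => G y j 0)); last exact/funext.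
  rewrite (_ : (fun y => _) = (fun y => g x j 0 +
     ((tjacobian g x)^T *m (y - x)) j 0)); last by apply/funext => z; rewrite mxE.
  apply: (@cvgD _ _ _ (nbhs y)); first exact: cvg_cst.
  apply: (@cvg_mulmx _ _ (nbhs y) _ _ _ (fun=> (tjacobian g x)^T)); last exact: contx.
  exact: cvg_cst.
have [[r r0 rP]|[mu [pi [mupi0 mu0 mupi]]]] :=
  strictly_feasible_or_multiplier A b K0 cK convK convu contu.
  have [y [Ky uy Hy]] : exists y, [/\ K y, forall i, u y i 0 <= - r & A *m y + b = 0].
    by apply: rP; rewrite normr0 ltW.
  have : 0 <= P y.
    by apply: stat => // i; rewrite -/(G y) -uG (le_lt_trans (uy _)) // oppr_lt0.
  by have := uy (lshift m 0); rewrite uP; lra.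
pose tau := mu (lshift m 0) 0; pose xi := dsubmx mu.
have xi0 i : 0 <= xi i 0 by rewrite mxE.
have taux y : K y -> 0 <= tau * P y + dot xi (G y) + dot pi (A *m y + b).
  move=> Ky; have := mupi y Ky; rewrite -[mu]vsubmxK /u dot_col_mx.
  by rewrite {1}/dot big_ord1 !mxE.
have tau0 : 0 < tau.
  rewrite lt_neqAle mu0 andbT; apply/eqP => tau0.
  have : M0 K g h x (xi, pi).
    apply: multiplier_in_M0 => // y Ky; rewrite affh //.
    have := taux y Ky; rewrite -tau0 mul0r add0r => /le_trans; apply.
    by rewrite lerD2r; apply: dot_sum_le => // i; exact: linearization_le.
  rewrite qual => -[xi00 pi00]; apply: mupi0; rewrite pi00; congr (_, _).
  apply/colP => i; case: (split_ordP i) => j ->; rewrite [RHS]mxE.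
    by rewrite (ord1 j) tau0.
  by have := congr1 (fun v : 'cV[R]_m => v j 0) xi00; rewrite !mxE.
pose xi' := tau^-1 *: xi; pose pi' := tau^-1 *: pi.
have lag y : K y -> 0 <= P y + dot xi' (G y) + dot pi' (A *m y + b).
  move=> Ky; rewrite !dotZl -addrA -mulrDr.
  have -> : P y = tau^-1 * (tau * P y) by rewrite mulKf // gt_eqF.
  by rewrite -mulrDr mulr_ge0 ?invr_ge0 ?(ltW tau0) // addrA taux.
have xi'0 i : 0 <= xi' i 0 by rewrite mxE mulr_ge0 // invr_ge0 ltW.
have Px : P x = 0 by rewrite /P !subrr dot0r addr0.
have Gx : G x = g x by rewrite /G subrr mulmx0 addr0.
have xig : dot xi' (g x) = 0.
  apply/eqP; rewrite eq_le; apply/andP; split.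
    by rewrite -(dot0r xi'); apply: dot_sum_le => // i; rewrite [leRHS]mxE.
  by have := lag x Kx; rewrite Px Gx -affh // hx dot0r addr0 add0r.
split=> //; exists xi', pi'; split.
  split=> // y y0; rewrite dotBr xig subr0.
  by rewrite -(dot0r xi'); apply: dot_sum_le => // i; rewrite [leRHS]mxE.
exists (- (gradient f x + tjacobian g x *m xi' + tjacobian h x *m pi')), 0; split.
- split=> // y Ky; have := lag y Ky.
  rewrite dotNl !dotDl !dot_mulmxl tjacobian_affine //.
  have -> : A *m y + b = A *m (y - x).
    by rewrite mulmxBr -[RHS]addr0 -hx affh // addrA subrK.
  rewrite /P /G dotDr xig; lra.
- by split=> // y Ky; rewrite dot0l.
- by apply/colP => i; rewrite !mxE; ring.
Qed.

End Optimality.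

(** * Sequences driven by steps of infinite sum *)
Section Sequences.
Context {R : realType}.
Implicit Types (w gamma : nat -> R).

Lemma increasing_seq_ge (s : nat -> nat) k : increasing_seq s -> (k <= s k)%N.
Proof.
move=> incs; elim: k => // k IH; apply: leq_ltn_trans IH _.
have := incs k.+1 k; rewrite ltnn !leEnat => h.
by rewrite ltnNge h.
Qed.

(** Summing the decrements bounds the partial sums of [gamma], against
    divergence. *)
Lemma no_infinite_descent w gamma a c N : 0 < a ->
  series gamma @ \oo --> +oo -> (forall k, c <= w k) ->
  ~ (forall k, (N <= k)%N -> w k.+1 <= w k - a * gamma k).
Proof.
move=> a0 /cvgryPge div cw dec.
have tele j : w (N + j)%N <=
    w N - a * (series gamma (N + j)%N - series gamma N).
  elim: j => [|j IH]; first by rewrite addn0 subrr mulr0 subr0.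
  have := dec (N + j)%N (leq_addr _ _).
  by rewrite addnS seriesSr; lra.
have [M _ HM] := div (series gamma N + (w N - c + 1) / a).
have /= H1 := HM (N + M)%N (leq_addl _ _).
have := tele M; have := cw (N + M)%N.
have : w N - c + 1 <= a * (series gamma (N + M)%N - series gamma N).
  by rewrite mulrC -ler_pdivrMr //; lra.
lra.
Qed.

(** Once [E * gamma k <= e / 2], values below [e] stay below [e], and values above
    [e] decrease by at least [gamma k * (e / 2)]; the latter cannot last. *)
Lemma damped_sequence_le (v gamma : nat -> R) E e : 0 < e ->
  (forall k, 0 <= v k) -> (forall k, 0 < gamma k <= 1) ->
  gamma @ \oo --> (0 : R) -> series gamma @ \oo --> +oo ->
  (forall k, v k.+1 <= (1 - gamma k) * v k + E * gamma k ^+ 2) ->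
  \forall k \near \oo, v k <= e.
Proof.
move=> e0 v0 g01 g0 div rec.
have E1 : 0 < `|E| + 1 by rewrite ltr_wpDl.
have /cvgrPdist_le/(_ (e / 2 / (`|E| + 1))) := g0.
rewrite !divr_gt0 // => /(_ isT)[N _ HN].
have small k : (N <= k)%N -> v k.+1 <= v k - gamma k * (v k - e / 2).
  move=> Nk; have /andP[gk0 gk1] := g01 k.
  have := HN k Nk; rewrite /= sub0r normrN gtr0_norm // ler_pdivlMr // => gE.
  have : E * gamma k ^+ 2 <= gamma k * (e / 2).
    rewrite expr2 mulrCA ler_wpM2l ?(ltW gk0) //.
    apply: le_trans gE; rewrite mulrC ler_wpM2l ?(ltW gk0) //.
    by rewrite (le_trans (ler_norm E)) // lerDl.
  have := rec k; lra.
have [[M NM vM]|never] := pselect (exists2 M, (N <= M)%N & v M <= e).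
  exists M => // k /= /subnKC <-; elim: (k - M)%N => [|j IH]; first by rewrite addn0.
  have /andP[gk0 gk1] := g01 (M + j)%N.
  have := small (M + j)%N (leq_trans NM (leq_addr _ _)).
  rewrite addnS; nra.
exfalso; apply: (@no_infinite_descent v gamma (e / 2) 0 N); rewrite ?divr_gt0 //.
move=> k Nk; have := small k Nk; have /andP[gk0 gk1] := g01 k.
have : e < v k by rewrite ltNge; apply/negP => ve; apply: never; exists k.
nra.
Qed.

(** If all directions within [rho] of [l] had length at least [delta], the
    decrease [a * gamma * |d|^2] would dominate [a * delta] times the length
    [gamma * |d|] of the step.  Starting close to [l] once [w] has nearly reached
    its infimum, the sequence could then never leave the ball of radius [rho], and
    [w] would decrease without bound. *)
Lemma short_steps_near_limit (V : normedModType R) (x d : nat -> V) l s w gamma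
    a c N rho delta :
  0 < a -> (forall k, 0 < gamma k) -> series gamma @ \oo --> +oo ->
  (forall k, x k.+1 = x k + gamma k *: d k) ->
  (forall k, c <= w k) ->
  (forall k, (N <= k)%N -> w k.+1 <= w k - a * gamma k * `|d k| ^+ 2) ->
  increasing_seq s -> x \o s @ \oo --> l -> 0 < rho -> 0 < delta ->
  exists2 k, `|l - x k| < rho & `|d k| < delta.
Proof.
move=> a0 g0 div step cw dec incs xl rho0 delta0.
apply: contrapT => nex.
have long k : `|l - x k| < rho -> delta <= `|d k|.
  by move=> h; rewrite leNgt; apply/negP => h2; apply: nex; exists k.
have mono i j : (N <= i)%N -> w (i + j)%N <= w i.
  move=> Ni; elim: j => [|j IH]; first by rewrite addn0.
  rewrite addnS; apply: le_trans IH.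
  apply: le_trans (dec _ (leq_trans Ni (leq_addr _ _))) _.
  by rewrite gerBl !mulr_ge0 ?exprn_ge0 ?(ltW a0) ?(ltW (g0 _)).
pose S : set R := [set w k | k in [set k | (N <= k)%N]].
have lbS : has_lbound S by exists c => _ [k _ <-].
have infS : has_inf S by split=> //; exists (w N), N => /=.
set eps := a * delta * (rho / 2).
have eps0 : 0 < eps by rewrite !mulr_gt0 // divr_gt0.
have [_ [N1 /= NN1 <-] wN1] := inf_adherent eps0 infS.
have wlow j : (N <= j)%N -> w N1 - eps < w j.
  by move=> Nj; have : inf S <= w j by [apply: ge_inf => //; exists j]; lra.
have rho2 : 0 < rho / 2 by rewrite divr_gt0.
have /cvgrPdist_lt/(_ _ rho2)[M _ HM] := xl.
pose i := s (maxn M N1).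
have N1i : (N1 <= i)%N.
  exact: leq_trans (leq_maxr M N1) (increasing_seq_ge _ incs).
have xi : `|l - x i| < rho / 2 by apply: (HM (maxn M N1)); exact: leq_maxl.
have Ni : (N <= i)%N by exact: leq_trans NN1 N1i.
have wi : w i <= w N1 by rewrite -(subnKC N1i) mono.
have near_l k : a * delta * `|x (i + k)%N - x i| <= w i - w (i + k)%N ->
    `|l - x (i + k)%N| < rho.
  move=> h; have : a * delta * `|x (i + k)%N - x i| < a * delta * (rho / 2).
    by rewrite -/eps; have := wlow (i + k)%N (leq_trans Ni (leq_addr _ _)); lra.
  rewrite ltr_pM2l ?mulr_gt0 // => h2.
  rewrite (_ : l - _ = (l - x i) - (x (i + k)%N - x i)).
    by rewrite (le_lt_trans (ler_normB _ _)) //; lra.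
  by rewrite opprB addrA subrK.
have stay k : a * delta * `|x (i + k)%N - x i| <= w i - w (i + k)%N.
  elim: k => [|k IH]; first by rewrite addn0 !subrr normr0 mulr0.
  have dk := long _ (near_l k IH).
  have := dec (i + k)%N (leq_trans Ni (leq_addr _ _)).
  rewrite addnS step; set g := gamma _; set D := `|d _|.
  have gp : 0 < g by exact: g0.
  have : `|x (i + k)%N + g *: d (i + k)%N - x i| <= `|x (i + k)%N - x i| + g * D.
    by rewrite addrAC (le_trans (ler_normD _ _)) // normrZ gtr0_norm.
  move=> h1 h2.
  have : a * delta * `|x (i + k)%N + g *: d (i + k)%N - x i| <=
         a * delta * (`|x (i + k)%N - x i| + g * D).
    by rewrite ler_wpM2l // mulr_ge0 // ltW.
  have : a * g * (delta * D) <= a * g * D ^+ 2.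
    rewrite expr2 ler_wpM2l ?mulr_ge0 ?(ltW a0) ?(ltW gp) //.
    by apply: ler_wpM2r => //; exact: normr_ge0.
  move: IH; lra.
apply: (@no_infinite_descent w gamma (a * delta ^+ 2) c i) => //.
  by rewrite mulr_gt0 // exprn_gt0.
move=> k ik; have := dec k (leq_trans Ni ik).
have : delta <= `|d k| by apply: long; rewrite -(subnKC ik); exact: near_l (stay _).
move=> dk h; apply: le_trans h _; rewrite lerD2l lerN2 mulrAC.
rewrite ler_wpM2l ?mulr_ge0 ?(ltW a0) ?(ltW (g0 _)) //.
by rewrite lerXn2r // nnegrE ltW // (lt_le_trans delta0).
Qed.

End Sequences.

(** * The subproblem *)
Lemma strongly_convex_gradient_le (R : realType) n (c : R) (D : set 'cV[R]_n) F d :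
  strongly_convex_on c D F -> differentiable F 0 ->
  (forall s : R, 0 <= s <= 1 -> D (s *: d)) ->
  F 0 + dot (gradient F 0) d + c / 2 * dot d d <= F d.
Proof.
move=> scF dF Dd.
have Ds (s : R) : 0 <= s <= 1 -> D (s *: d + (1 - s) *: 0).
  by rewrite scaler0 addr0; exact: Dd.
have Dd1 : D d by have := Dd 1; rewrite scale1r ler01 lexx; exact.
have D0 : D 0 by have := Dd 0; rewrite scale0r ler01 lexx; exact.
suff : dot (gradient F 0) d <= F d - F 0 - c / 2 * dot d d by lra.
apply: (@gradient_dir_le _ _ _ _ _ _ (c / 2 * dot d d)) => // s /andP[s0 s1].
have := scF d 0 Dd1 D0 Ds s; rewrite (ltW s0) s1 => /(_ isT).
rewrite scaler0 addr0 subr0 add0r; lra.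
Qed.

Lemma coordD (R : realType) m n (M N : 'M[R]_(m, n)) i j :
  (M + N) i j = M i j + N i j.
Proof. by rewrite mxE. Qed.

Lemma coordB (R : realType) m n (M N : 'M[R]_(m, n)) i j :
  (M - N) i j = M i j - N i j.
Proof. by rewrite !mxE. Qed.

Lemma coordZ (R : realType) m n a (M : 'M[R]_(m, n)) i j :
  (a *: M) i j = a * M i j.
Proof. by rewrite mxE. Qed.

Section Subproblem.
Context {R : realType} {n m p : nat}.
Variables (K : set 'cV[R]_n) (f q : 'cV[R]_n -> R) (g : 'cV[R]_n -> 'cV[R]_m).
Variables (h : 'cV[R]_n -> 'cV[R]_p) (A : 'M[R]_(p, n)) (b : 'cV[R]_p).
Variable ft : 'cV[R]_n -> 'cV[R]_n -> R.
Hypothesis convK : convex_set K.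
Hypothesis diffg : forall x, K x -> differentiable g x.
Hypothesis convg : forall i, convex_function K (fun x => g x i 0).
Hypothesis affh : forall x, K x -> h x = A *m x + b.
Variable beta : R.
Hypothesis diamK : forall x y, K x -> K y -> `|x - y| <= beta.

Section Restoration.
Variable r : R.
Hypothesis r0 : 0 < r.
Hypothesis slaterr : forall z, `|z| <= r ->
  exists y, [/\ K y, forall i, g y i 0 <= - r & A *m y + b = z].

(** From [x], move by the fraction [s = phi / (phi + r)] towards a point [y] which
    has slack [r] in the inequalities and whose equality residual is
    [- (r / phi) h x].  The fraction balances the violation [(1 - s) phi] with the
    gained slack [s r], and the residuals of the equality constraint cancel.  When
    [phi = 0] the convention [0^-1 = 0] gives the right-hand side 0 and [s = 0]. *)
Lemma small_feasible_direction x : K x ->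
  exists2 d, subproblem_feasible K g A b x d & `|d| <= phi g h x / r * beta.
Proof.
move=> Kx; set v := phi g h x.
have v0 : 0 <= v := phi_ge0 g h x.
have hv : `|h x| <= v := le_phi_h g h x.
have vr0 : 0 < v + r by rewrite ltr_wpDl.
have [|y [Ky gy Hy]] := slaterr (z := - (r / v) *: h x).
  rewrite normrZ normrN ger0_norm ?divr_ge0 ?(ltW r0) //.
  have [v00|v00] := eqVneq v 0; first by rewrite v00 invr0 mulr0 mul0r ltW.
  by rewrite mulrAC ler_pdivrMr ?lt_def ?v00 // ler_wpM2l // ltW.
set s := v / (v + r).
have s0 : 0 <= s by rewrite divr_ge0 // ltW.
have s1 : s <= 1 by rewrite ler_pdivrMr // mul1r lerDl ltW.
have sE : (1 - s) * v = s * r by rewrite /s; field; rewrite gt_eqF.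
exists (s *: (y - x)); last first.
  rewrite normrZ ger0_norm //; apply: ler_pM => //; last exact: diamK.
  by rewrite /s ler_wpM2l // lef_pV2 ?posrE // lerDr.
split.
- move=> i; have g1 := gy i; have g2 := le_phi_g g h x i.
  have g3 := linearization_le diffg convg i Kx Ky.
  rewrite coordD in g3; rewrite -scalemxAr coordD coordZ.
  have : (1 - s) * g x i 0 <= (1 - s) * v by rewrite ler_wpM2l // subr_ge0.
  nra.
- have hE : A *m (x + s *: (y - x)) + b = (1 - s) *: h x + s *: (A *m y + b).
    rewrite affh // mulmxDr -scalemxAr mulmxBr; apply/colP => i.
    by rewrite !mxE; ring.
  rewrite hE Hy scalerA -scalerDl.
  have [v00|v00] := eqVneq v 0.
    have -> : h x = 0 by apply/eqP; rewrite -normr_le0 (le_trans hv) // v00.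
    by rewrite scaler0.
  have -> : 1 - s + s * - (r / v) = 0 by rewrite /s; field; rewrite v00 gt_eqF.
  by rewrite scale0r.
- by apply: convex_set_segment => //; rewrite s0 s1.
Qed.

End Restoration.

Variables (c Lf Lq r : R) (Od : set 'cV[R]_n).
Hypothesis ballOd : linf_ball beta `<=` Od.
Hypothesis r0 : 0 < r.
Hypothesis slaterr : forall z, `|z| <= r ->
  exists y, [/\ K y, forall i, g y i 0 <= - r & A *m y + b = z].
Hypothesis c0 : 0 < c.
Hypothesis scft : forall x, K x -> strongly_convex_on c Od (fun d => ft d x).
Hypothesis diffft : forall x, K x -> differentiable (fun d => ft d x) 0.
Hypothesis gradft : forall x, K x -> gradient (fun d => ft d x) 0 = gradient f x.
Hypothesis Lf0 : 0 < Lf.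
Hypothesis Lq0 : 0 < Lq.
Hypothesis lipft : forall x d, K x -> linf_ball beta d ->
  ft d x - ft 0 x <= Lf * `|d|.
Hypothesis lipq : forall x y, K x -> K y -> q x - q y <= Lq * `|x - y|.

(** The solution [d] is compared with the short feasible direction [d'], whose
    value exceeds that of [0] by at most a constant times [phi]; strong convexity
    bounds the value at [d] from below by its linearization at [0] plus
    [c / 2 |d|^2]. *)
Lemma model_decrease x d : K x -> subproblem_solution K q g A b ft x d ->
  dot (gradient f x) d + (q (x + d) - q x) <=
  (Lf + Lq) * (beta / r) * phi g h x - c / 2 * `|d| ^+ 2.
Proof.
move=> Kx [[_ _ Kxd] opt].
have [d' Fd' nd'] := small_feasible_direction r0 slaterr Kx.
have [_ _ Kxd'] := Fd'.
have ball0 e : K (x + e) -> linf_ball beta e.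
  by move=> Kxe; have := diamK Kxe Kx; rewrite addrCK.
have h1 := opt d' Fd'.
have h2 := lipft Kx (ball0 _ Kxd').
have h3 := lipq Kxd' Kx; rewrite addrCK in h3.
have h4 : ft 0 x + dot (gradient (fun d => ft d x) 0) d + c / 2 * dot d d <= ft d x.
  apply: (strongly_convex_gradient_le (scft Kx) (diffft Kx)) => s s01.
  apply: ballOd; apply: ball0.
  by have := convex_set_segment convK Kx Kxd s01; rewrite addrCK.
rewrite gradft // in h4.
have h5 : c / 2 * `|d| ^+ 2 <= c / 2 * dot d d.
  by rewrite ler_wpM2l ?divr_ge0 ?(ltW c0) // sqr_norm_le_dot.
have h6 : (Lf + Lq) * `|d'| <= (Lf + Lq) * (beta / r) * phi g h x.
  rewrite -mulrA ler_wpM2l ?addr_ge0 ?(ltW Lf0) ?(ltW Lq0) //.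
  by rewrite (le_trans nd') // mulrC mulrA mulrAC.
lra.
Qed.

(** Along a feasible direction of the subproblem the linearized constraints
    decrease the inequality violation by the factor [1 - s], up to the quadratic
    remainder of [g], and the affine residual is scaled exactly by [1 - s]. *)
Lemma phi_step L x d s : 
  (forall y z, K y -> K z -> `|tjacobian g y - tjacobian g z| <= L * `|y - z|) ->
  K x -> subproblem_feasible K g A b x d -> 0 <= s <= 1 ->
  phi g h (x + s *: d) <= (1 - s) * phi g h x + n%:R * L * s ^+ 2 * `|d| ^+ 2.
Proof.
move=> lipg Kx [gd hd Kxd] s01; have /andP[s0 s1] := s01.
have s10 : 0 <= 1 - s by rewrite subr_ge0.
have Kxs : K (x + s *: d).
  by have := convex_set_segment convK Kx Kxd s01; rewrite addrCK.
have rem0 : 0 <= n%:R * L * s ^+ 2 * `|d| ^+ 2.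
  have : 0 <= L * `|d|.
    by have := lipg _ _ Kxd Kx; rewrite addrCK; apply: le_trans.
  move=> Ld; have -> : n%:R * L * s ^+ 2 * `|d| ^+ 2 =
    n%:R * s ^+ 2 * (`|d| * (L * `|d|)) by ring.
  apply: mulr_ge0; last exact: mulr_ge0.
  by apply: mulr_ge0 => //; exact: sqr_ge0.
have phix0 := phi_ge0 g h x.
apply: phi_le; first by rewrite addr_ge0 // mulr_ge0.
- move=> i.
  have := @descent_inequality _ _ K (fun y => g y i 0) L x d s convK _ _ Kx Kxd s01.
  rewrite dot_gradient_component; last exact: diffg.
  move=> /(_ _ _)/le_trans; apply.
  + by move=> y Ky; apply: differentiable_component; exact: diffg.
  + move=> y z Ky Kz; apply: le_trans (lipg y z Ky Kz).
    apply: norm_le_coord => // k.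
    have entry w : K w -> gradient (fun y => g y i 0) w k 0 = tjacobian g w k i.
      move=> Kw; have := dot_gradient_component i (delta_mx k 0) (diffg Kw).
      by rewrite dot_gradient -colE !mxE.
    have -> : (gradient (fun y => g y i 0) y - gradient (fun y => g y i 0) z) k 0 =
        (tjacobian g y - tjacobian g z) k i.
      apply: etrans (coordB _ _ _ _) (etrans _ (esym (coordB _ _ _ _))).
      by congr (_ - _); exact: entry.
    exact: coord_le_norm.
  + rewrite lerD2r; have := gd i; rewrite coordD; have := le_phi_g g h x i; nra.
- have -> : h (x + s *: d) = (1 - s) *: h x.
    rewrite affh // affh // -[RHS]addr0 -(scaler0 _ s) -hd mulmxDr -scalemxAr.
    by rewrite mulmxDr; apply/colP => i; rewrite !mxE; ring.
  rewrite normrZ ger0_norm // ler_wpDr // ler_wpM2l //.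
  exact: le_phi_h.
Qed.

End Subproblem.

(** * Vanishing directions near a point *)
Section Stationarity.
Context {R : realType} {n m p : nat}.
Variables (K : set 'cV[R]_n) (f q : 'cV[R]_n -> R) (g : 'cV[R]_n -> 'cV[R]_m).
Variables (h : 'cV[R]_n -> 'cV[R]_p) (A : 'M[R]_(p, n)) (b : 'cV[R]_p).
Variable ft : 'cV[R]_n -> 'cV[R]_n -> R.
Hypothesis convK : convex_set K.
Hypothesis affh : forall x, K x -> h x = A *m x + b.
Hypothesis convq : convex_function K q.
Variable beta : R.
Hypothesis diamK : forall x y, K x -> K y -> `|x - y| <= beta.
Variable l : 'cV[R]_n.
Hypothesis Fl : feasible K g h l.
Hypothesis contq : {for l, continuous q}.
Hypothesis contg : {for l, continuous g}.
Hypothesis contJ : {for l, continuous (tjacobian g)}.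
Hypothesis contft : forall d, linf_ball beta d ->
  {for (d, l), continuous (fun z => ft z.1 z.2)}.
Hypothesis diffft : differentiable (fun d => ft d l) 0.
Hypothesis gradft : gradient (fun d => ft d l) 0 = gradient f l.
Hypothesis vanishing : forall rho delta : R, 0 < rho -> 0 < delta ->
  exists x d, [/\ K x, `|l - x| < rho, subproblem_solution K q g A b ft x d &
                  `|d| < delta].

Let strict y := [/\ K y, A *m y + b = 0 &
  forall i, (g l + (tjacobian g l)^T *m (y - l)) i 0 < 0].

(** A strictly feasible [y] stays feasible for the subproblems at all points near
    [l].  If it were better than the zero direction at [l], then by continuity it would
    beat every small direction at every point close to [l], including the
    solutions supplied by the vanishing hypothesis.  Only values are compared, so
    no regularity of the solution map is needed. *)
Lemma zero_step_optimal y : strict y -> ft 0 l + q l <= ft (y - l) l + q y.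
Proof.
move=> [Ky Hy Gy]; have [gl hl Kl] := Fl.
rewrite leNgt; apply/negP => better.
pose F := nbhs ((l, 0) : 'cV[R]_n * 'cV[R]_n).
have c1 : (fun z : 'cV[R]_n * 'cV[R]_n => z.1) @ F --> l by exact: cvg_fst.
have c2 : (fun z : 'cV[R]_n * 'cV[R]_n => z.2) @ F --> (0 : 'cV[R]_n) by exact: cvg_snd.
have c3 : (fun z : 'cV[R]_n * 'cV[R]_n => y - z.1) @ F --> y - l.
  exact: (cvgB (cvg_cst y) c1).
have b0 : linf_ball beta (0 : 'cV[R]_n).
  by have := diamK Kl Kl; rewrite subrr.
have T1 : (fun z : 'cV[R]_n * 'cV[R]_n => ft z.2 z.1) @ F --> ft 0 l.
  exact: (cvg_comp2 c2 c1 (contft b0)).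
have T2 : (fun z : 'cV[R]_n * 'cV[R]_n => ft (y - z.1) z.1) @ F --> ft (y - l) l.
  exact: (cvg_comp2 c3 c1 (contft (diamK Ky Kl))).
have T3 : (fun z : 'cV[R]_n * 'cV[R]_n => q (z.1 + z.2)) @ F --> q l.
  have : (fun z : 'cV[R]_n * 'cV[R]_n => z.1 + z.2) @ F --> l.
    by rewrite -[X in _ --> X]addr0; exact: (cvgD c1 c2).
  by move=> c12; exact: cvg_comp c12 contq.
have T4 i : (fun z : 'cV[R]_n * 'cV[R]_n =>
    (g z.1 + (tjacobian g z.1)^T *m (y - z.1)) i 0) @ F -->
    (g l + (tjacobian g l)^T *m (y - l)) i 0.
  rewrite coordD; under eq_cvg do rewrite coordD.
  apply: cvgD; first by apply: cvg_coord; exact: cvg_comp c1 contg.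
  apply: (@cvg_mulmx _ _ F).
    apply: (cvg_comp _ (@trmx _ _ _)); last exact: trmx_continuous.
    exact: cvg_comp c1 contJ.
  exact: c3.
have T5 : (fun z : 'cV[R]_n * 'cV[R]_n =>
    (ft z.2 z.1 + q (z.1 + z.2)) - (ft (y - z.1) z.1 + q y)) @ F -->
    (ft 0 l + q l) - (ft (y - l) l + q y).
  exact: (cvgB (cvgD T1 T3) (cvgD T2 (cvg_cst (q y)))).
have N1 : \forall z \near F,
    0 < (ft z.2 z.1 + q (z.1 + z.2)) - (ft (y - z.1) z.1 + q y).
  by apply: (cvgr_gt _ T5); rewrite subr_gt0.
have N2 : \forall z \near F, forall i,
    (g z.1 + (tjacobian g z.1)^T *m (y - z.1)) i 0 < 0.
  by apply: filter_forall => i; exact: (cvgr_lt _ (T4 i)).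
have [[S T] /= [/nbhs_ballP[e1 /= e10 He1] /nbhs_ballP[e2 /= e20 He2]] ST] :=
  filterI N1 N2.
have [x [d [Kx lx [_ opt] de]]] := vanishing e10 e20.
have [] := ST (x, d).
  split=> /=; first by apply: He1; rewrite -ball_normE.
  by apply: He2; rewrite -ball_normE /= sub0r normrN.
rewrite subr_gt0 /= ltNge => /negP + Gx; apply.
have -> : q y = q (x + (y - x)) by rewrite addrC subrK.
apply: opt; split=> [i| |]; first exact/ltW.
  by rewrite [x + _]addrC subrK.
by rewrite addrC subrK.
Qed.

(** Points of the segment from [l] to a strictly feasible [y], other than [l], are
    again strictly feasible, so optimality along the segment can be
    differentiated at [l]. *)
Lemma zero_step_stationary y : strict y ->
  0 <= dot (gradient f l) (y - l) + (q y - q l).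
Proof.
move=> sy; have [Ky Hy Gy] := sy; have [gl hl Kl] := Fl.
suff : - (q y - q l) <= dot (gradient (fun d => ft d l) 0) (y - l).
  by rewrite gradft; lra.
apply: (@le_gradient_dir R n (fun d => ft d l) 0 (y - l) _ 0 diffft).
move=> s /andP[s0 s1].
have s01 : 0 <= s <= 1 by rewrite (ltW s0).
have sys : strict (l + s *: (y - l)).
  split; first exact: convex_set_segment.
    have Hl : A *m l + b = 0 by rewrite -(affh Kl).
    have -> : A *m (l + s *: (y - l)) + b =
        (1 - s) *: (A *m l + b) + s *: (A *m y + b).
      rewrite mulmxDr -scalemxAr mulmxBr; apply/colP => i; rewrite !mxE; ring.
    by rewrite Hl Hy !scaler0 addr0.
  move=> i; have := Gy i; have := gl i.
  rewrite addrCK -scalemxAr !coordD coordZ; nra.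
have := zero_step_optimal sys; rewrite addrCK add0r.
have := convex_function_segment convq Kl Ky s01; lra.
Qed.

End Stationarity.

(** * Convergence of the algorithm *)
(** The weight [M] of the violation in the merit function is the constant of the
    model decrease, so that the contraction of the violation pays exactly for the
    term [M * v0]; small steps make the quadratic remainders cost at most half of
    [c / 2]. *)
Lemma merit_step (R : realType) (f0 f1 q0 q1 qd v0 v1 G s e c M a1 a2 : R) :
  0 <= M -> 0 <= s -> 0 <= e ->
  f1 <= f0 + s * G + a1 * s ^+ 2 * e ->
  q1 <= q0 + s * (qd - q0) ->
  v1 <= (1 - s) * v0 + a2 * s ^+ 2 * e ->
  G + (qd - q0) <= M * v0 - c / 2 * e ->
  (a1 + M * a2) * s <= c / 4 ->
  f1 + q1 + M * v1 <= f0 + q0 + M * v0 - c / 4 * s * e.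
Proof.
move=> M0 s0 e0 Hf Hq Hv Hm Hs.
have H1 : M * v1 <= M * ((1 - s) * v0 + a2 * s ^+ 2 * e) by rewrite ler_wpM2l.
have H2 : s * (G + (qd - q0)) <= s * (M * v0 - c / 2 * e) by rewrite ler_wpM2l.
have H3 : (a1 + M * a2) * s * (s * e) <= c / 4 * (s * e).
  by rewrite ler_wpM2r // mulr_ge0.
lra.
Qed.

Theorem theorem5p5 (R : realType) (n m p : nat) (K : set 'cV[R]_n)
    (f q : 'cV[R]_n -> R) (g : 'cV[R]_n -> 'cV[R]_m)
    (h : 'cV[R]_n -> 'cV[R]_p) (A : 'M[R]_(p, n)) (b : 'cV[R]_p)
    (beta c : R) (Od Ox : set 'cV[R]_n) (ft : 'cV[R]_n -> 'cV[R]_n -> R)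
    (gamma : nat -> R) (x : nat -> 'cV[R]_n) :
  problem_data K f q g h ->
  assumptionA K f beta c Od Ox ft ->
  assumptionC Od Ox ft ->
  assumptionD K g h A b ->
  (forall nu, 0 < gamma nu <= 1) ->
  gamma @ \oo --> (0 : R) ->
  series gamma @ \oo --> +oo ->
  K (x 0%N) ->
  simplified_DSM K f q g h A b ft gamma x ->
  [/\ bounded_set (range x),
      forall nu, K (x nu) &
      forall l, limit_of_subsequence x l -> KKT K f q g h l].
Proof.
move=> [[K0 closedK convK] [U [openU KU [diffU lipU] [gdiffU glipU] [hdiffU _]]]].
move=> convq [Uq [openUq KUq lipUq]].
move=> [[beta0 supbeta [openOd ballOd] [openOx KOx]] ftdiff [c0 scft] ftcont gradft].
move=> lipft [[V [openV KV convV convVg affV]] bK [xs Fxs] qual].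
move=> g01 g0 div Kx0 run.
have cK : compact K by exact: bounded_closed_compact_col.
have diamK y z : K y -> K z -> `|y - z| <= beta.
  move=> Ky Kz; apply: le_trans (ltW supbeta).
  apply: sup_upper_bound; last by exists (y, z).
  split; first by exists `|y - z|, (y, z).
  have [B [_ HB]] := bK; exists ((B + 1) + (B + 1)) => _ [[u v] /= [Ku Kv] <-].
  by rewrite (le_trans (ler_normB _ _)) // lerD // HB // ltrDl.
have b0 : linf_ball beta (0 : 'cV[R]_n) by rewrite /linf_ball /= normr0 ltW.
have fdiff y : K y -> differentiable f y by move=> /KU /diffU.
have gdiff y : K y -> differentiable g y by move=> /KU /gdiffU.
have hdiff y : K y -> differentiable h y by move=> /KU /hdiffU.
have gconv i : convex_function K (fun y => g y i 0).
  move=> t y z /set_mem /KV Vy /set_mem /KV Vz.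
  by apply: convVg; exact: mem_set.
have haff y : K y -> h y = A *m y + b by move=> /KV /affV.
have qcont y : K y -> {for y, continuous q}.
  by move=> /KUq; exact: locally_lipschitz_continuous.
have ftdiff0 y : K y -> differentiable (fun d => ft d y) 0.
  by move=> Ky; have [] := ftdiff 0 y (ballOd _ b0) (KOx _ Ky).
have [L1 L10 HL1] := locally_lipschitz_compact cK KU lipU.
have [L2 L20 HL2] := locally_lipschitz_compact cK KU glipU.
have [Lq Lq0 HLq] := locally_lipschitz_compact cK KUq lipUq.
have [|Lf Lf0 HLf] := locally_lipschitz_compact
    (compact_setX (@linf_ball_compact R n beta) cK) _ lipft.
  by move=> [d y] /= [/ballOd Od_d /KOx].
have ftlip y d : K y -> linf_ball beta d -> ft d y - ft 0 y <= Lf * `|d|.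
  move=> Ky bd; have := HLf (d, y) (0, y) (conj bd Ky) (conj b0 Ky).
  rewrite prod_normE /= subr0 subrr normr0 max_l //; exact: (le_trans (ler_norm _)).
have qlip y z : K y -> K z -> q y - q z <= Lq * `|y - z|.
  by move=> Ky Kz; apply: le_trans (HLq y z Ky Kz); exact: ler_norm.
have [_ _ Kxs] := Fxs.
have [r r0 slaterr] := slater convK gdiff hdiff gconv haff cK Fxs (qual _ Kxs).
pose M := (Lf + Lq) * (beta / r).
have M0 : 0 <= M by rewrite mulr_ge0 ?addr_ge0 ?divr_ge0 ?ltW.
have /choice[d dP] : forall nu, exists d,
    subproblem_solution K q g A b ft (x nu) d /\ x nu.+1 = x nu + gamma nu *: d.
  by move=> nu; have [_ [d]] := run nu; exists d.
have g01' k : 0 <= gamma k <= 1.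
  by have /andP[gk0 gk1] := g01 k; rewrite ltW.
have Kx nu : K (x nu).
  elim: nu => // nu IH; have [[[_ _ Kxd] _] ->] := dP nu.
  by have := convex_set_segment convK IH Kxd (g01' nu); rewrite addrCK.
have Kxd k : K (x k + d k) by have [[[]]] := dP k.
have phistep k : phi g h (x k.+1) <=
    (1 - gamma k) * phi g h (x k) + n%:R * L2 * gamma k ^+ 2 * `|d k| ^+ 2.
  have [[Fd _] ->] := dP k.
  exact: (phi_step convK gdiff haff HL2 (Kx k) Fd (g01' k)).
have dbeta k : `|d k| <= beta.
  by have := diamK _ _ (Kxd k) (Kx k); rewrite addrCK.
split=> //.
  have [B [Br HB]] := bK; exists B; split=> // B' BB' _ [nu _ <-].
  exact: HB.
move=> l [s incs xl].
have Kl : K l.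
  by apply: (closed_cvg _ closedK _ _ xl); apply: nearW => k; exact: Kx.
(* The directions are bounded by [beta], so the quadratic remainder of the
   violation is a multiple of [gamma ^+ 2]. *)
have phi_small e : 0 < e -> \forall k \near \oo, phi g h (x k) <= e.
  move=> e0; apply: (damped_sequence_le (E := n%:R * L2 * beta ^+ 2)) g0 div _ => //.
    by move=> k; exact: phi_ge0.
  move=> k; apply: le_trans (phistep k) _; rewrite lerD2l mulrAC.
  rewrite ler_wpM2r ?sqr_ge0 // ler_wpM2l ?mulr_ge0 ?(ltW L20) //.
  by rewrite lerXn2r ?nnegrE // ltW.
have gcont : {for l, continuous g} by apply: differentiable_continuous; exact: gdiff.
have hcont : {for l, continuous h} by apply: differentiable_continuous; exact: hdiff.
have phi_sub e : 0 < e -> \forall k \near \oo, phi g h (x (s k)) <= e.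
  move=> /phi_small[N _ HN]; exists N => // k /= Nk; apply: HN => /=.
  exact: leq_trans Nk (increasing_seq_ge _ incs).
have Fl : feasible K g h l.
  split=> //.
    move=> i; apply/ler_addgt0Pr => e e0; rewrite add0r.
    have gl : (fun k => g (x (s k)) i 0) @ \oo --> g l i 0.
      by apply: cvg_coord; exact: (cvg_comp _ _ xl gcont).
    apply: (closed_cvg (fun t => t <= e) _ _ _ gl); first exact: closed_le.
    by apply: filterS (phi_sub e e0) => k; apply: le_trans; exact: le_phi_g.
  apply/colP => j; rewrite mxE; apply/eqP; rewrite -normr_le0.
  apply/ler_addgt0Pr => e e0; rewrite add0r.
  have hl : (fun k => `|h (x (s k)) j 0|) @ \oo --> `|h l j 0|.
    by apply: cvg_norm; apply: cvg_coord; exact: (cvg_comp _ _ xl hcont).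
  apply: (closed_cvg (fun t => t <= e) _ _ _ hl); first exact: closed_le.
  apply: filterS (phi_sub e e0) => k; apply: le_trans.
  exact: le_trans (coord_le_norm _ _ _) (le_phi_h _ _ _).
pose w k := f (x k) + q (x k) + M * phi g h (x k).
have [cf Hcf] : exists cf, forall y, K y -> cf <= f y.
  by apply: compact_lower_bound => // y /fdiff; exact: differentiable_continuous.
have [cq Hcq] : exists cq, forall y, K y -> cq <= q y.
  exact: compact_lower_bound.
have wlow k : cf + cq <= w k.
  rewrite /w -[cf + cq]addr0; apply: lerD; last first.
    by apply: mulr_ge0 => //; exact: phi_ge0.
  by apply: lerD; [exact: Hcf|exact: Hcq].
(* [a] bounds the quadratic remainders of the merit function; from [N] on the
   steps are short enough for the decrease to dominate them. *)
pose a := n%:R * L1 + M * (n%:R * L2).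
have [N _ HN] : \forall k \near \oo, a * gamma k <= c / 4.
  have ag : a * gamma k @[k --> \oo] --> a * 0 by apply: cvgM => //; exact: cvg_cst.
  by apply: (cvgr_le _ ag); rewrite mulr0 divr_gt0.
have wdec k : (N <= k)%N -> w k.+1 <= w k - c / 4 * gamma k * `|d k| ^+ 2.
  move=> Nk; have [sol xE] := dP k.
  have /andP[gk0 gk1] := g01' k.
  apply: (@merit_step _ _ _ _ _ (q (x k + d k)) _ _ (dot (gradient f (x k)) (d k))
     (gamma k) _ c M (n%:R * L1) (n%:R * L2)) => //.
  - by rewrite xE; exact: descent_inequality convK fdiff HL1 (Kx k) (Kxd k) (g01' k).
  - rewrite xE.
    by have := convex_function_segment convq (Kx k) (Kxd k) (g01' k); rewrite addrCK.
  - exact: (model_decrease convK gdiff gconv haff diamK ballOd r0 slaterr c0 scft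
      ftdiff0 gradft Lf0 Lq0 ftlip qlip (Kx k) sol).
  - exact: HN.
apply: (KKT_of_stationary convK gdiff hdiff gconv haff cK convq qcont Fl (qual _ Kl)).
move=> y Ky Gy Hy.
apply: (zero_step_stationary convK haff convq diamK Fl (qcont _ Kl) gcont
  _ _ (ftdiff0 _ Kl) (gradft _ Kl)) => //.
- exact: locally_lipschitz_continuous glipU (KU _ Kl).
- by move=> e be; have [] := ftcont e l (ballOd _ be) (KOx _ Kl).
- move=> rho delta rho0 delta0.
  have [|||k lk dk] := short_steps_near_limit (d := d) _ _ div _ wlow wdec incs xl
    rho0 delta0.
  + by rewrite divr_gt0.
  + by move=> k; have /andP[] := g01 k.
  + by move=> k; have [] := dP k.
  + by exists (x k), (d k); split=> //; have [] := dP k.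
Qed.
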